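(* Suppose $f\in\mathcal{O}_2=\mathcal{O}_{\mathbb{C}^2,0}$, $f(0)=0$, defines a reduced plane curve, let $\Phi=(\phi_1,\phi_2)$ be (parameterizations of) a pair of branches $B_1,B_2$ of a polar curve of $f$ defined by $\frac{\partial f}{\partial x}-a\frac{\partial f}{\partial y}=0$ ($a\in\mathbb{C}$), and let $g\in\mathcal{O}_2$. i) If $D(g,f)\circ\Phi=0$, then $g_D\circ\Phi\in\Phi^*(J(f)_D)$ if and only if $i(g,B_i)\ge e_i$ for $i=1,2$. ii) If the order of $D(g,f)\circ\Phi$ equals $\min\{\,i(g,B_1)+e_2,\ i(g,B_2)+e_1\,\}$, then $g_D\circ\Phi\in\Phi^*(J(f)_D)$ if and only if $i(g,B_i)\ge e_i+C(B_1,B_2)$ for $i=1,2$.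
   Context: Branches of the polar curve are given by writing $x$ as a fractional power series in $y$; the two branches are parameterized with a common parameter $t$ and common $y$-coordinate: $\phi_i(t)=(x_i(t),t^N)$, $i=1,2$, with $x_i\in\mathcal{O}_1$, $x_i(0)=0$, for a common integer $N\ge1$ ($\mathcal{O}_1=\mathbb{C}\{t\}$). All orders below are measured with respect to this common parameter. $i(g,B_i)$ is the order of $g\circ\phi_i$; $e_i=i(\partial f/\partial y,B_i)$ is the order of $\frac{\partial f}{\partial y}\circ\phi_i$; $C(B_1,B_2)$, the contact of the two branches, is the order of $x_1-x_2$. $J(f)=(\partial f/\partial x,\partial f/\partial y)$. For $h\in\mathcal{O}_2$, $h_D=(h\circ p_1,h\circ p_2)$, where $p_1,p_2$ are the projections of $\mathbb{C}^2\times\mathbb{C}^2$ to its factors; so $h_D\circ\Phi=(h\circ\phi_1,h\circ\phi_2)$. $J(f)_D$ is the submodule of $\mathcal{O}^2_{\mathbb{C}^2\times\mathbb{C}^2,(0,0)}$ generated by all $h_D$ with $h\in J(f)$, and $\Phi^*(J(f)_D)$ is the $\mathcal{O}_1$-submodule of $\mathcal{O}_1^2$ generated by the pullbacks of its elements. $D(g,f)$ is the determinant of the matrix whose columns are $g_D$ and $(\partial f/\partial y)_D$, so $$D(g,f)\circ\Phi=(g\circ\phi_1)\left(\tfrac{\partial f}{\partial y}\circ\phi_2\right)-(g\circ\phi_2)\left(\tfrac{\partial f}{\partial y}\circ\phi_1\right).$$ *)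

(* Defs.v *)
From HB Require Import structures.
From mathcomp Require Import all_boot all_order all_algebra.
From mathcomp Require Import mpoly.
From mathcomp Require Import boolp classical_sets reals constructive_ereal ereal.
From mathcomp Require Import complex.

Set Implicit Arguments.
Unset Strict Implicit.
Unset Printing Implicit Defensive.

Import Order.TTheory GRing.Theory Num.Theory.

Local Open Scope ring_scope.

Record fps (K : Type) (n : nat) := Fps { fcoef : 'X_{1..n} -> K }.

HB.instance Definition _ (K : Type) (n : nat) := gen_eqMixin (fps K n).
HB.instance Definition _ (K : Type) (n : nat) := gen_choiceMixin (fps K n).

Lemma fpsP (K : Type) (n : nat) (F G : fps K n) :
  (forall m, fcoef F m = fcoef G m) -> F = G.
Proof. by case: F => F; case: G => G /= /funext ->. Qed.

Section FormalPowerSeries.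
Variables (K : comNzRingType) (n : nat).
Implicit Types (F G H : fps K n) (m : 'X_{1..n}).

Definition fps0 : fps K n := Fps (fun=> 0).
Definition fps_opp F : fps K n := Fps (fun m => - fcoef F m).
Definition fps_add F G : fps K n := Fps (fun m => fcoef F m + fcoef G m).

Fact fps_addA : associative fps_add.
Proof. by move=> F G H; apply: fpsP => m /=; rewrite addrA. Qed.
Fact fps_addC : commutative fps_add.
Proof. by move=> F G; apply: fpsP => m /=; rewrite addrC. Qed.
Fact fps_add0 : left_id fps0 fps_add.
Proof. by move=> F; apply: fpsP => m /=; rewrite add0r. Qed.
Fact fps_addN : left_inverse fps0 fps_opp fps_add.
Proof. by move=> F; apply: fpsP => m /=; rewrite addNr. Qed.

HB.instance Definition _ :=
  GRing.isZmodule.Build (fps K n) fps_addA fps_addC fps_add0 fps_addN.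

Definition fps1 : fps K n := Fps (fun m => (m == 0%MM)%:R).
Definition fps_mul F G : fps K n :=
  Fps (fun m => \sum_(k : 'X_{1..n < (mdeg m).+1, (mdeg m).+1}
                      | m == (k.1 + k.2)%MM) fcoef F k.1 * fcoef G k.2).

Definition fps_trunc (d : nat) F : {mpoly K[n]} :=
  \sum_(k : 'X_{1..n < d}) fcoef F k *: 'X_[k].

Lemma mcoeff_fps_trunc d F m :
  (fps_trunc d F)@_m = if (mdeg m < d)%N then fcoef F m else 0.
Proof.
rewrite /fps_trunc raddf_sum /=; case: ifP => md.
  rewrite (bigD1 (BMultinom md)) //= mcoeffZ mcoeffX eqxx mulr1 big1 ?addr0 //.
  move=> k; rewrite bmeqP /= => /negPf kNm.
  by rewrite mcoeffZ mcoeffX kNm mulr0.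
rewrite big1 // => k _; rewrite mcoeffZ mcoeffX; case: eqP => [km|]; last first.
  by rewrite mulr0.
by move: (bmdeg k); rewrite km md.
Qed.

Lemma mcoeffM_lt d (p q p' q' : {mpoly K[n]}) :
    (forall m, (mdeg m < d)%N -> p@_m = p'@_m) ->
    (forall m, (mdeg m < d)%N -> q@_m = q'@_m) ->
  forall m, (mdeg m < d)%N -> (p * q)@_m = (p' * q')@_m.
Proof.
move=> pp qq m md; rewrite !(mcoeff_poly_mul _ _ md).
by apply: eq_bigr => -[k1 k2] _ /=; rewrite pp ?qq // bmdeg.
Qed.

Lemma fcoef_mul d F G m : (mdeg m < d)%N ->
  fcoef (fps_mul F G) m = (fps_trunc d F * fps_trunc d G)@_m.
Proof.
move=> md /=; rewrite (@mcoeffM_lt (mdeg m).+1 _ _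
  (fps_trunc (mdeg m).+1 F) (fps_trunc (mdeg m).+1 G)) //.
- rewrite mcoeffM; apply: eq_bigr => -[k1 k2] _ /=.
  by rewrite !mcoeff_fps_trunc !bmdeg.
- move=> k km; rewrite !mcoeff_fps_trunc km.
  by rewrite (leq_trans km md).
- move=> k km; rewrite !mcoeff_fps_trunc km.
  by rewrite (leq_trans km md).
Qed.

Lemma mcoeff_trunc_mul d F G m : (mdeg m < d)%N ->
  (fps_trunc d (fps_mul F G))@_m = (fps_trunc d F * fps_trunc d G)@_m.
Proof. by move=> md; rewrite mcoeff_fps_trunc md (fcoef_mul _ _ md). Qed.

Fact fps_mulA : associative fps_mul.
Proof.
move=> F G H; apply: fpsP => m; rewrite !(fcoef_mul _ _ (ltnSn _)).
rewrite (@mcoeffM_lt (mdeg m).+1 _ _ (fps_trunc (mdeg m).+1 F)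
  (fps_trunc (mdeg m).+1 G * fps_trunc (mdeg m).+1 H)) //; last first.
  exact: mcoeff_trunc_mul.
rewrite mulrA; apply: (@mcoeffM_lt (mdeg m).+1) => //.
by move=> k km; rewrite mcoeff_trunc_mul.
Qed.
Fact fps_mulC : commutative fps_mul.
Proof.
by move=> F G; apply: fpsP => m; rewrite !(fcoef_mul _ _ (ltnSn _)) mulrC.
Qed.
Fact fps_mul1 : left_id fps1 fps_mul.
Proof.
move=> F; apply: fpsP => m; rewrite (fcoef_mul _ _ (ltnSn _)).
rewrite (@mcoeffM_lt (mdeg m).+1 _ _ 1 (fps_trunc (mdeg m).+1 F)) //.
  by rewrite mul1r mcoeff_fps_trunc ltnSn.
by move=> k km; rewrite mcoeff_fps_trunc km mcoeff1.
Qed.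
Fact fps_mulDl : left_distributive fps_mul fps_add.
Proof.
move=> F G H; apply: fpsP => m /=; rewrite -big_split /=.
by apply: eq_bigr => k _; rewrite mulrDl.
Qed.
Fact fps_oner_neq0 : fps1 != 0.
Proof.
apply/eqP => /(congr1 (fun F => fcoef F 0%MM)) /= /eqP.
by rewrite eqxx oner_eq0.
Qed.

HB.instance Definition _ := GRing.Zmodule_isComNzRing.Build (fps K n)
  fps_mulA fps_mulC fps_mul1 fps_mulDl fps_oner_neq0.

Definition fps_scale (c : K) F : fps K n := Fps (fun m => c * fcoef F m).

Fact fps_scaleA c1 c2 F :
  fps_scale c1 (fps_scale c2 F) = fps_scale (c1 * c2) F.
Proof. by apply: fpsP => m /=; rewrite mulrA. Qed.
Fact fps_scale1 : left_id 1 fps_scale.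
Proof. by move=> F; apply: fpsP => m /=; rewrite mul1r. Qed.
Fact fps_scaleDr : right_distributive fps_scale +%R.
Proof. by move=> c F G; apply: fpsP => m /=; rewrite mulrDr. Qed.
Fact fps_scaleDl F : {morph fps_scale^~ F : c1 c2 / c1 + c2}.
Proof. by move=> c1 c2; apply: fpsP => m /=; rewrite mulrDl. Qed.

HB.instance Definition _ := GRing.Zmodule_isLmodule.Build K (fps K n)
  fps_scaleA fps_scale1 fps_scaleDr fps_scaleDl.

Fact fps_scaleAl (c : K) F G : c *: (F * G) = (c *: F) * G.
Proof.
apply: fpsP => m /=; rewrite mulr_sumr.
by apply: eq_bigr => k _; rewrite mulrA.
Qed.

HB.instance Definition _ := GRing.Lmodule_isLalgebra.Build K (fps K n)
  fps_scaleAl.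

Lemma fcoef0 m : fcoef (0 : fps K n) m = 0. Proof. by []. Qed.
Lemma fcoefD F G m : fcoef (F + G) m = fcoef F m + fcoef G m.
Proof. by []. Qed.
Lemma fcoefN F m : fcoef (- F) m = - fcoef F m. Proof. by []. Qed.
Lemma fcoefZ c F m : fcoef (c *: F) m = c * fcoef F m. Proof. by []. Qed.
Lemma fcoef1 m : fcoef (1 : fps K n) m = (m == 0%MM)%:R. Proof. by []. Qed.
Lemma fcoefM F G m : fcoef (F * G) m =
  \sum_(k : 'X_{1..n < (mdeg m).+1, (mdeg m).+1} | m == (k.1 + k.2)%MM)
     fcoef F k.1 * fcoef G k.2.
Proof. by []. Qed.

Definition fps_var (i : 'I_n) : fps K n := Fps (fun m => (m == U_(i)%MM)%:R).

Definition fps_deriv (i : 'I_n) F : fps K n :=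
  Fps (fun m => (m i).+1%:R * fcoef F (m + U_(i))%MM).

End FormalPowerSeries.

Section Substitution.
Variables (K : comNzRingType) (n p : nat).

Definition fps_monom (phi : 'I_n -> fps K p) (k : 'X_{1..n}) : fps K p :=
  \prod_(i < n) phi i ^+ k i.

(* Only meaningful when every phi i has zero constant term: then the terms with
   mdeg k > mdeg m do not contribute to the coefficient of degree m, so that
   the sum below is the full coefficient of F(phi_0, ..., phi_(n-1)). *)
Definition fps_comp (F : fps K n) (phi : 'I_n -> fps K p) : fps K p :=
  Fps (fun m => \sum_(k : 'X_{1..n < (mdeg m).+1})
                  fcoef F k * fcoef (fps_monom phi k) m).

Definition fps_vanish (d : nat) (F : fps K p) :=
  forall m, (mdeg m < d)%N -> fcoef F m = 0.

Lemma fps_vanishM a b F G :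
  fps_vanish a F -> fps_vanish b G -> fps_vanish (a + b) (F * G).
Proof.
move=> Fa Gb m mab; rewrite fcoefM big1 // => -[k1 k2] /= /eqP mE.
have [k1a|ak1] := ltnP (mdeg k1) a; first by rewrite Fa ?mul0r.
rewrite Gb ?mulr0 // -(ltn_add2l a); apply: leq_ltn_trans mab.
by rewrite [leqRHS](congr1 (@mdeg p) mE) mdegD leq_add2r.
Qed.

Lemma fps_vanishX a F k : fps_vanish a F -> fps_vanish (a * k) (F ^+ k).
Proof.
move=> Fa; elim: k => [|k IHk]; first by rewrite muln0 => m.
by rewrite exprS mulnS; apply: fps_vanishM.
Qed.

Lemma fps_vanish_monom (phi : 'I_n -> fps K p) k :
    (forall i, fcoef (phi i) 0%MM = 0) ->
  fps_vanish (mdeg k) (fps_monom phi k).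
Proof.
move=> phi0; rewrite mdegE /fps_monom.
elim/big_ind2: _ => // [a F b G|i _]; first exact: fps_vanishM.
rewrite -[X in fps_vanish X]mul1n; apply: fps_vanishX => m.
by rewrite ltnS leqn0 mdeg_eq0 => /eqP->.
Qed.

Lemma big_bmultinom_widen (d d' : nat) (g : 'X_{1..n} -> K) : (d <= d')%N ->
    (forall k, (d <= mdeg k)%N -> g k = 0) ->
  \sum_(k : 'X_{1..n < d}) g k = \sum_(k : 'X_{1..n < d'}) g k.
Proof.
move=> dd' g0.
rewrite [RHS](bigID (fun k : 'X_{1..n < d'} => (mdeg k < d)%N)) /=.
rewrite [X in _ = _ + X]big1 ?addr0; last first.
  by move=> k; rewrite -leqNgt => /g0.
pose h (k : 'X_{1..n < d}) := BMultinom (leq_trans (bmdeg k) dd').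
rewrite (reindex_omap h (fun k : 'X_{1..n < d'} => insub (val k))) /=; last first.
  by move=> k kd; rewrite insubT /=; congr Some; apply: val_inj.
by apply: eq_bigl => k; rewrite bmdeg valK eqxx.
Qed.

Lemma fcoef_comp (F : fps K n) (phi : 'I_n -> fps K p) d m :
    (forall i, fcoef (phi i) 0%MM = 0) -> (mdeg m < d)%N ->
  fcoef (fps_comp F phi) m =
    \sum_(k : 'X_{1..n < d}) fcoef F k * fcoef (fps_monom phi k) m.
Proof.
move=> phi0 md /=.
apply: (big_bmultinom_widen (g := fun k => fcoef F k * fcoef (fps_monom phi k) m)).
  by [].
by move=> k mk; rewrite (fps_vanish_monom phi0) ?mulr0.
Qed.

End Substitution.

Section Convergence.
Variable K : numFieldType.

Definition wnorm (n d : nat) (r : K) (F : fps K n) : K :=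
  \sum_(m : 'X_{1..n < d}) `|fcoef F m| * r ^+ mdeg m.

(* Absolute convergence on some polydisc |z_i| <= r, r > 0. *)
Definition convergent (n : nat) (F : fps K n) : bool :=
  `[< exists2 r : K, 0 < r & exists M : K, forall d, wnorm d r F <= M >].

Section WeightedNorm.
Variable n : nat.
Implicit Types (F G : fps K n) (r s : K).

Lemma wnorm_ge0 d r F : 0 <= r -> 0 <= wnorm d r F.
Proof. by move=> r0; apply: sumr_ge0 => m _; rewrite mulr_ge0 ?exprn_ge0. Qed.

Lemma wnormN d r F : wnorm d r (- F) = wnorm d r F.
Proof. by apply: eq_bigr => m _; rewrite fcoefN normrN. Qed.

Lemma wnormZ d r c F : wnorm d r (c *: F) = `|c| * wnorm d r F.
Proof.
by rewrite mulr_sumr; apply: eq_bigr => m _; rewrite fcoefZ normrM mulrA.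
Qed.

Lemma wnormD d r F G : 0 <= r ->
  wnorm d r (F + G) <= wnorm d r F + wnorm d r G.
Proof.
move=> r0; rewrite -big_split /=; apply: ler_sum => m _.
by rewrite -mulrDl ler_wpM2r ?exprn_ge0 // fcoefD ler_normD.
Qed.

Lemma wnorm_radius d r s F : 0 <= s -> s <= r -> wnorm d s F <= wnorm d r F.
Proof.
move=> s0 sr; apply: ler_sum => m _.
by rewrite ler_wpM2l // lerXn2r // nnegrE (le_trans s0).
Qed.

Lemma wnorm1 d r : wnorm d r (1 : fps K n) <= 1.
Proof.
rewrite /wnorm; case: d => [|d].
  by rewrite big1 // => k; have := bmdeg k.
rewrite (bigD1 (@bm0 n d)) //= eqxx normr1 mdeg0 expr0 mulr1.
rewrite big1 ?addr0 // => k; rewrite bmeqP /= => /negPf k0.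
by rewrite k0 normr0 mul0r.
Qed.

Lemma wnormM d r F G : 0 <= r ->
  wnorm d r (F * G) <= wnorm d r F * wnorm d r G.
Proof.
move=> r0.
pose h (k : 'X_{1..n < d, d}) :=
  `|fcoef F k.1| * r ^+ mdeg k.1 * (`|fcoef G k.2| * r ^+ mdeg k.2).
have h0 k : 0 <= h k by rewrite !mulr_ge0 ?exprn_ge0.
have -> : wnorm d r F * wnorm d r G = \sum_k h k.
  by rewrite big_distrlr /= pair_big /=; apply: eq_bigr.
apply: (@le_trans _ _ (\sum_(m : 'X_{1..n < d})
    \sum_(k : 'X_{1..n < d, d} | val m == (k.1 + k.2)%MM) h k)).
  apply: ler_sum => m _.
  have -> : fcoef (F * G) m = (fps_trunc d F * fps_trunc d G)@_m.
    by rewrite -[LHS]/(fcoef (fps_mul F G) m) (fcoef_mul _ _ (bmdeg m)).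
  rewrite (mcoeff_poly_mul _ _ (bmdeg m)).
  apply: le_trans (_ : (\sum_(k : 'X_{1..n < d, d} | val m == (k.1 + k.2)%MM)
     `|fcoef F k.1 * fcoef G k.2|) * r ^+ mdeg m <= _).
    rewrite ler_wpM2r ?exprn_ge0 //.
    apply: le_trans (ler_norm_sum _ _ _) _; apply: ler_sum => -[k1 k2] _ /=.
    by rewrite !mcoeff_fps_trunc !bmdeg.
  rewrite mulr_suml; apply: ler_sum => k /eqP /= ->.
  by rewrite /h mdegD exprD normrM mulrACA.
rewrite (exchange_big_dep predT) //=; apply: ler_sum => k _.
have [kd|dk] := ltnP (mdeg (bmnm k.1 + bmnm k.2)%MM) d.
  by rewrite (big_pred1 (BMultinom kd)) // => m; rewrite bmeqP.
rewrite big1 // => m /eqP mE; move: (bmdeg m).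
by rewrite mE ltnNge dk.
Qed.

Lemma wnormX d r F k : 0 <= r -> wnorm d r (F ^+ k) <= wnorm d r F ^+ k.
Proof.
move=> r0; elim: k => [|k IHk]; first exact: wnorm1.
rewrite !exprS (le_trans (wnormM _ _ _ _)) // ler_wpM2l //.
exact: wnorm_ge0.
Qed.

Lemma wnorm_small r s d F : fcoef F 0%MM = 0 -> 0 <= s -> s <= 1 -> 0 <= r ->
  wnorm d (s * r) F <= s * wnorm d r F.
Proof.
move=> F0 s0 s1 r0; rewrite mulr_sumr; apply: ler_sum => m _.
have [m0|m0] := posnP (mdeg m).
  move/eqP: m0; rewrite mdeg_eq0 => /eqP ->.
  by rewrite F0 normr0 !mul0r mulr0.
rewrite exprMn [s * _]mulrCA ler_wpM2l // ler_wpM2r ?exprn_ge0 //.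
by rewrite -(prednK m0) exprS ler_piMr // exprn_ile1.
Qed.

Lemma ler_sum_inj (I J : finType) (h : I -> J) (g : J -> K) :
  injective h -> (forall j, 0 <= g j) -> \sum_i g (h i) <= \sum_j g j.
Proof.
move=> hI g0; rewrite [leRHS](bigID (mem (h @: [set: I]))) /=.
rewrite big_imset /=; last by move=> i j _ _; apply: hI.
rewrite [X in _ <= X + _](eq_bigl xpredT); last by move=> i; rewrite inE.
by rewrite lerDl sumr_ge0.
Qed.

Lemma wnorm_deriv r d (i : 'I_n) F : 0 < r ->
  wnorm d (r / 2) (fps_deriv i F) <= r^-1 * wnorm d.+1 r F.
Proof.
move=> r0; have r0' := ltW r0.
have hP (m : 'X_{1..n < d}) : (mdeg (m + U_(i))%MM < d.+1)%N.
  by rewrite mdegD mdeg1 addn1 ltnS bmdeg.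
pose h (m : 'X_{1..n < d}) := BMultinom (hP m).
pose g (m : 'X_{1..n < d.+1}) := `|fcoef F m| * r ^+ mdeg m.
have hI : injective h.
  by move=> k l /(congr1 val) /= /addIm kl; apply: val_inj.
apply: (@le_trans _ _ (r^-1 * \sum_m g (h m))); last first.
  rewrite ler_wpM2l ?invr_ge0 // ler_sum_inj // => m.
  by rewrite mulr_ge0 ?exprn_ge0.
rewrite mulr_sumr; apply: ler_sum => m _; rewrite /g /= mdegD mdeg1 addn1.
rewrite exprS [leRHS]mulrCA mulKf ?gt_eqF // expr_div_n normrM mulrAC.
rewrite [leRHS]mulrC ler_wpM2r // normr_nat mulrCA ler_piMr ?exprn_ge0 //.
rewrite ler_pdivrMr ?exprn_gt0 // mul1r -natrX ler_nat.
apply: (@leq_trans (mdeg m).+1); last exact: ltn_expl.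
by rewrite ltnS mdegE (bigD1 i) //= leq_addr.
Qed.

End WeightedNorm.

Lemma common_radius (r s : K) : 0 < r -> 0 < s ->
  exists2 t : K, 0 < t & (t <= r) && (t <= s).
Proof.
move=> r0 s0; have [rs|sr] := real_leP (gtr0_real r0) (gtr0_real s0).
  by exists r; rewrite ?lexx.
by exists s; rewrite ?lexx ?andbT // ltW.
Qed.

Section Closure.
Variable n : nat.
Implicit Types F G : fps K n.

Lemma convergent_var i : convergent (fps_var K i : fps K n).
Proof.
apply/asboolP; exists 1 => //; exists 1 => d; rewrite /wnorm.
have [d1|d1] := ltnP 1 d; last first.
  rewrite big1 ?ler01 // => m _ /=; case: eqP => [mE|]; last by rewrite normr0 mul0r.
  by have := bmdeg m; rewrite mE mdeg1 ltnNge d1.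
have Ud : (mdeg U_(i)%MM < d)%N by rewrite mdeg1.
rewrite (bigD1 (BMultinom Ud)) //= eqxx normr1 expr1n mulr1.
rewrite big1 ?addr0 // => m; rewrite bmeqP /= => /negPf ->.
by rewrite normr0 mul0r.
Qed.

Lemma convergent_deriv i F : convergent F -> convergent (fps_deriv i F).
Proof.
move=> /asboolP[r r0 [M FM]]; apply/asboolP; exists (r / 2).
  by rewrite divr_gt0.
exists (r^-1 * M) => d; apply: le_trans (wnorm_deriv _ _ _ r0) _.
by rewrite ler_wpM2l ?invr_ge0 // ltW.
Qed.

Lemma convergent_common F G : convergent F -> convergent G ->
  exists2 r : K, 0 < r & exists M N, [/\ 0 <= M, 0 <= N &
    forall d, wnorm d r F <= M /\ wnorm d r G <= N].
Proof.
move=> /asboolP[r r0 [M FM]] /asboolP[s s0 [N GN]].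
have [t t0 /andP[tr ts]] := common_radius r0 s0.
have FM' d : wnorm d t F <= M.
  exact: le_trans (wnorm_radius _ _ (ltW t0) tr) _.
have GN' d : wnorm d t G <= N.
  exact: le_trans (wnorm_radius _ _ (ltW t0) ts) _.
exists t => //; exists M, N; split => //.
- exact: le_trans (wnorm_ge0 0 _ (ltW t0)) (FM' _).
- exact: le_trans (wnorm_ge0 0 _ (ltW t0)) (GN' _).
Qed.

Fact convergent_subalg : subalg_closed (@convergent n).
Proof.
split=> [|c F G cF cG|F G cF cG].
- by apply/asboolP; exists 1 => //; exists 1 => d; apply: wnorm1.
- have [r r0 [M [N [M0 N0 FGM]]]] := convergent_common cF cG.
  apply/asboolP; exists r => //; exists (`|c| * M + N) => d.
  rewrite (le_trans (wnormD _ _ _ (ltW r0))) // wnormZ.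
  by have [FM GN] := FGM d; rewrite lerD // ler_wpM2l.
- have [r r0 [M [N [M0 N0 FGM]]]] := convergent_common cF cG.
  apply/asboolP; exists r => //; exists (M * N) => d.
  rewrite (le_trans (wnormM _ _ _ (ltW r0))) //.
  by have [FM GN] := FGM d; rewrite ler_pM // wnorm_ge0 // ltW.
Qed.

HB.instance Definition _ :=
  GRing.isSubalgClosed.Build K (fps K n) (@convergent n) convergent_subalg.

End Closure.

Section CompConvergent.
Variables n p : nat.

Lemma wnorm_monom d r (phi : 'I_n -> fps K p) k : 0 <= r ->
  wnorm d r (fps_monom phi k) <= \prod_(i < n) wnorm d r (phi i) ^+ k i.
Proof.
move=> r0; apply: (@proj2 (0 <= \prod_(i < n) wnorm d r (phi i) ^+ k i)).
apply: (big_ind2 (fun F c => 0 <= c /\ wnorm d r F <= c)).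
- by split; rewrite ?ler01 ?wnorm1.
- move=> F a G b [a0 Fa] [b0 Gb]; split; first exact: mulr_ge0.
  by rewrite (le_trans (wnormM _ _ _ r0)) // ler_pM // wnorm_ge0.
- by move=> i _; split; rewrite ?exprn_ge0 ?wnorm_ge0 ?wnormX.
Qed.

Lemma wnorm_comp d r s (F : fps K n) (phi : 'I_n -> fps K p) :
    0 <= r -> 0 <= s -> (forall i, fcoef (phi i) 0%MM = 0) ->
    (forall i, wnorm d s (phi i) <= r) ->
  wnorm d s (fps_comp F phi) <= wnorm d r F.
Proof.
move=> r0 s0 phi0 phir.
apply: (@le_trans _ _ (\sum_(k : 'X_{1..n < d})
    `|fcoef F k| * wnorm d s (fps_monom phi k))); last first.
  apply: ler_sum => k _; rewrite ler_wpM2l //.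
  rewrite (le_trans (wnorm_monom _ _ _ s0)) // mdegE -prodrXr.
  apply: ler_prod => i _; apply/andP; split; first by rewrite exprn_ge0 ?wnorm_ge0.
  by apply: lerXn2r; rewrite ?nnegrE ?wnorm_ge0.
under [leRHS]eq_bigr do rewrite mulr_sumr.
rewrite exchange_big /=; apply: ler_sum => m _.
rewrite (fcoef_comp _ phi0 (bmdeg m)).
under eq_bigr do rewrite mulrA -normrM.
by rewrite -mulr_suml ler_wpM2r ?exprn_ge0 ?ler_norm_sum.
Qed.

Lemma convergent_family (phi : 'I_n -> fps K p) :
    (forall i, convergent (phi i)) ->
  exists2 s : K, 0 < s & exists M, [/\ 0 <= M &
    forall i d, wnorm d s (phi i) <= M].
Proof.
move=> cphi.
suff /(_ (enum 'I_n))[s s0 [M [M0 phiM]]] : forall e : seq 'I_n,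
    exists2 s : K, 0 < s & exists M, [/\ 0 <= M &
      forall i d, i \in e -> wnorm d s (phi i) <= M].
  by exists s => //; exists M; split=> // i d; rewrite phiM ?mem_enum.
elim=> [|i e [s s0 [M [M0 phiM]]]].
  by exists 1 => //; exists 0.
have [r r0 [N phiN]] := asboolP _ (cphi i).
have [t t0 /andP[ts tr]] := common_radius s0 r0.
have phiN' d : wnorm d t (phi i) <= N.
  exact: le_trans (wnorm_radius _ _ (ltW t0) tr) _.
have N0 : 0 <= N by exact: le_trans (wnorm_ge0 0 _ (ltW t0)) (phiN' _).
exists t => //; exists (M + N); split=> [|j d]; first exact: addr_ge0.
rewrite inE => /orP[/eqP->|je].
  by rewrite (le_trans (phiN' d)) ?lerDr.
rewrite (le_trans (wnorm_radius _ _ (ltW t0) ts)) //.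
by rewrite (le_trans (phiM _ _ je)) ?lerDl.
Qed.

Lemma convergent_comp (F : fps K n) (phi : 'I_n -> fps K p) :
    convergent F -> (forall i, convergent (phi i)) ->
    (forall i, fcoef (phi i) 0%MM = 0) ->
  convergent (fps_comp F phi).
Proof.
move=> /asboolP[r r0 [N FN]] /convergent_family[s s0 [M [M0 phiM]]] phi0.
have M1 : 0 < 1 + M by rewrite ltr_wpDr.
have q0 : 0 < r / (1 + M) by rewrite divr_gt0.
have [t t0 /andP[t1 tr]] := common_radius ltr01 q0.
apply/asboolP; exists (t * s); first exact: mulr_gt0.
exists N => d; apply: le_trans (FN d).
apply: wnorm_comp => // [||i]; [exact: ltW|by rewrite mulr_ge0 ?ltW|].
rewrite (le_trans (wnorm_small _ _ _ t1 _)) ?(ltW t0) ?(ltW s0) //.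
rewrite (@le_trans _ _ (r / (1 + M) * (1 + M))) //; last first.
  by rewrite divfK // gt_eqF.
by rewrite ler_pM ?(ltW t0) ?wnorm_ge0 ?(ltW s0) // (le_trans (phiM _ _)) // lerDr.
Qed.

End CompConvergent.

End Convergence.

(* K{z_0, ..., z_(n-1)} *)
Record cvps (K : numFieldType) (n : nat) :=
  Cvps { cvps_val : fps K n; _ : cvps_val \in @convergent K n }.

Section ConvergentPowerSeries.
Variables (K : numFieldType) (n : nat).

HB.instance Definition _ := [isSub for @cvps_val K n].
HB.instance Definition _ := [Choice of cvps K n by <:].
HB.instance Definition _ := [SubChoice_isSubComNzRing of cvps K n by <:].
HB.instance Definition _ := [SubZmodule_isSubLmodule of cvps K n by <:].
HB.instance Definition _ :=
  [SubNzRing_SubLmodule_isSubLalgebra of cvps K n by <:].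
HB.instance Definition _ := GRing.Lalgebra_isComAlgebra.Build K (cvps K n).

Definition cvcoef (F : cvps K n) (m : 'X_{1..n}) : K := fcoef (val F) m.

Definition cvvar (i : 'I_n) : cvps K n := Cvps (convergent_var K i).

Definition cvderiv (i : 'I_n) (F : cvps K n) : cvps K n :=
  Cvps (convergent_deriv i (valP F)).

End ConvergentPowerSeries.

(* F(phi_0, ..., phi_(n-1)) for phi_i in the maximal ideal; by val_cvcomp the
   default value of insubd is only used when some phi_i(0) is nonzero. *)
HB.lock Definition cvcomp (K : numFieldType) (n p : nat)
    (F : cvps K n) (phi : 'I_n -> cvps K p) : cvps K p :=
  insubd 0 (fps_comp (val F) (fun i => val (phi i))).

Lemma val_cvcomp (K : numFieldType) (n p : nat)
    (F : cvps K n) (phi : 'I_n -> cvps K p) :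
  (forall i, cvcoef (phi i) 0%MM = 0) ->
  val (cvcomp F phi) = fps_comp (val F) (fun i => val (phi i)).
Proof.
move=> phi0; rewrite cvcomp.unlock insubdK //.
by apply: convergent_comp => // [|i]; apply: valP.
Qed.

Section Span.
Variables (A : pzRingType) (V : lmodType A).

Definition submod_gen (S : set V) : set V :=
  [set v | exists (k : nat) (c : 'I_k -> A) (w : 'I_k -> V),
     (forall i, S (w i)) /\ v = \sum_(i < k) c i *: w i].

End Span.

Notation "''O[' R ]_ n" := (cvps R[i] n)
  (at level 8, n at level 2, format "''O[' R ]_ n").

Section PlaneCurves.
Variable R : realType.
Implicit Types (f g h : 'O[R]_2) (a : R[i]) (N : nat).

Local Open Scope ereal_scope.
Local Open Scope classical_set_scope.
Local Open Scope ring_scope.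

(* infimum of the degrees of the monomials that occur; +oo for the zero series *)
Definition cvord n (F : 'O[R]_n) : \bar R :=
  ereal_inf [set (mdeg m)%:R%:E | m in [set m | cvcoef F m != 0]].

(* f defines a (nonempty) plane curve germ whose local ring O_2/(f) is reduced *)
Definition reduced_curve f : Prop :=
  [/\ f != 0, cvcoef f 0%MM = 0 &
      forall h (k : nat), (exists u, h ^+ k = u * f) -> exists u, h = u * f].

(* coordinates (x, y) on C^2 *)
Definition dx f : 'O[R]_2 := cvderiv 0 f.
Definition dy f : 'O[R]_2 := cvderiv 1 f.

Definition polar f a : 'O[R]_2 := dx f - a *: dy f.

(* B t = (x(t), t^N) with x(0) = 0 *)
Definition is_branch_param N (B : 'I_2 -> 'O[R]_1) : Prop :=
  cvcoef (B 0) 0%MM = 0 /\ B 1 = cvvar R[i] 0 ^+ N.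

Definition is_polar_branch f a N (B : 'I_2 -> 'O[R]_1) : Prop :=
  [/\ polar f a != 0, is_branch_param N B & cvcomp (polar f a) B = 0].

Definition intersection_order g (B : 'I_2 -> 'O[R]_1) : \bar R :=
  cvord (cvcomp g B).

Definition contact (B1 B2 : 'I_2 -> 'O[R]_1) : \bar R := cvord (B1 0 - B2 0).

Definition jacobian_ideal f : set 'O[R]_2 :=
  [set h | exists u v, h = u * dx f + v * dy f].

(* C^2 x C^2 has coordinates (z_0, z_1, z_2, z_3) = (x_1, y_1, x_2, y_2) *)
Definition proj1_sq (i : 'I_2) : 'O[R]_(2 + 2) := cvvar R[i] (lshift 2 i).
Definition proj2_sq (i : 'I_2) : 'O[R]_(2 + 2) := cvvar R[i] (rshift 2 i).

Definition double_sq h : 'cV['O[R]_(2 + 2)]_2 :=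
  \col_(i < 2) cvcomp h (if i == 0 then proj1_sq else proj2_sq).

Definition jacobian_double f : set 'cV['O[R]_(2 + 2)]_2 :=
  submod_gen [set double_sq h | h in jacobian_ideal f].

Definition double_det g f : 'O[R]_(2 + 2) :=
  \det (row_mx (double_sq g) (double_sq (dy f)) : 'M_(1 + 1)).

Definition pair_param (B1 B2 : 'I_2 -> 'O[R]_1) (i : 'I_(2 + 2)) : 'O[R]_1 :=
  match split i with inl j => B1 j | inr j => B2 j end.

Definition pullback (Phi : 'I_(2 + 2) -> 'O[R]_1)
    (v : 'cV['O[R]_(2 + 2)]_2) : 'cV['O[R]_1]_2 :=
  map_mx (fun F => cvcomp F Phi) v.

Definition pullback_module (Phi : 'I_(2 + 2) -> 'O[R]_1)
    (M : set 'cV['O[R]_(2 + 2)]_2) : set 'cV['O[R]_1]_2 :=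
  submod_gen [set pullback Phi v | v in M].

End PlaneCurves.

(* Main.v *)
Require Import Defs.
From HB Require Import structures.
From mathcomp Require Import all_boot all_order all_algebra.
From mathcomp Require Import cyclic separable cyclotomic.
From mathcomp Require Import mpoly.
From mathcomp Require Import boolp classical_sets reals constructive_ereal ereal.
From mathcomp Require Import complex.

(** Write [x_i] for the first coordinate of [B_i], [F_i] and [g_i] for the
    pullbacks of [dy f] and [g] to [B_i], and [c = x_1 - x_2].

    On a branch of the polar curve [dx f = a * dy f], so an element of the
    jacobian ideal pulls back to the pair [(w_1 F_1, w_2 F_2)], where [w_i] is
    the pullback of some [w] in [O_2].  Both branches have second coordinate
    [t^N], hence [w_1 - w_2] is a multiple of [c]; conversely [w = 1] and
    [w = x] already generate all pairs congruent modulo [c].  So [g_D] pulls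
    back into the module exactly when [g_1 = p F_1], [g_2 = q F_2] with [c]
    dividing [p - q] ([pullback_moduleP]).  In the discrete valuation ring
    [O_1] inequalities of orders are divisibilities ([cvord_le_dvdP]), and as
    [D(g, f)] pulls back to [g_1 F_2 - g_2 F_1 = (p - q) F_1 F_2], what
    remains is cancellation.  If the determinant vanishes then [p = q].  If its
    order is that of the smaller of [g_1 F_2] and [g_2 F_1], then [c F_1 F_2],
    which divides the determinant, divides both terms, and [c F_i] divides
    [g_i].

    Cancelling requires [F_1] and [F_2] to be nonzero, and this is where [f]
    being reduced enters ([reduced_critical_branch]).  If [F_i = 0] then both
    partial derivatives of [f], hence also [f], vanish on [B_i].  After the
    ramified base change [y = t^N] the branch becomes the graph of a series,
    [P = x - x_i(t)] divides [F(x, t) = f(x, t^N)] twice, [F = P^2 H], and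
    [P H] is nilpotent modulo [F].  Taking traces over the group of [N]-th
    roots of unity brings this down to [O_2 / (f)], which has no nilpotents:
    [F] divides [t^N P H] ([ramify_radical]).  Then [P] divides [t^N], which is
    absurd.

    The calculus of series used here (substitution is a ring morphism, is
    associative, and obeys the chain rule) is obtained from polynomials by
    density ([fps_additive_density]); orders are additive because initial forms
    multiply ([fps_has_orderM]). *)

Set Implicit Arguments.
Unset Strict Implicit.
Unset Printing Implicit Defensive.

Import Order.TTheory GRing.Theory Num.Theory.
Local Open Scope ring_scope.

(** * Polynomials are dense in power series *)

Section Density.
Variables (K : comNzRingType) (n : nat).
Implicit Types (F G : fps K n) (p : {mpoly K[n]}) (m : 'X_{1..n}).

Definition fps_of_mpoly p : fps K n := Fps (fun m => p@_m).

Fact fps_of_mpoly_is_zmod_morphism : zmod_morphism fps_of_mpoly.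
Proof. by move=> p q; apply: fpsP => m /=; rewrite mcoeffB. Qed.
Fact fps_of_mpoly_is_monoid_morphism : monoid_morphism fps_of_mpoly.
Proof.
split=> [|p q]; apply: fpsP => m /=; first by rewrite mcoeff1.
by rewrite mcoeffM.
Qed.
HB.instance Definition _ := GRing.isZmodMorphism.Build {mpoly K[n]} (fps K n)
  fps_of_mpoly fps_of_mpoly_is_zmod_morphism.
HB.instance Definition _ := GRing.isMonoidMorphism.Build {mpoly K[n]} (fps K n)
  fps_of_mpoly fps_of_mpoly_is_monoid_morphism.

Lemma fps_of_mpolyZ c p : fps_of_mpoly (c *: p) = c *: fps_of_mpoly p.
Proof. by apply: fpsP => m /=; rewrite mcoeffZ. Qed.

Lemma fps_of_mpolyX i : fps_of_mpoly 'X_i = fps_var K i.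
Proof. by apply: fpsP => m /=; rewrite mcoeffX eq_sym. Qed.

Lemma fps_vanishD d F G : fps_vanish d F -> fps_vanish d G -> fps_vanish d (F + G).
Proof. by move=> F0 G0 m md; rewrite fcoefD F0 ?G0 ?addr0. Qed.

Lemma fps_vanishB d F G : fps_vanish d F -> fps_vanish d G -> fps_vanish d (F - G).
Proof. by move=> F0 G0 m md; rewrite fcoefD fcoefN F0 ?G0 ?subr0. Qed.

Lemma fps_vanishMl d F G : fps_vanish d F -> fps_vanish d (F * G).
Proof. by move=> F0; rewrite -[d]addn0; apply: fps_vanishM. Qed.

Lemma fps_vanishMr d F G : fps_vanish d G -> fps_vanish d (F * G).
Proof. by rewrite mulrC; apply: fps_vanishMl. Qed.

Lemma fps_vanish_sum (I : Type) (r : seq I) (P : pred I) d (H : I -> fps K n) :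
  (forall i, P i -> fps_vanish d (H i)) -> fps_vanish d (\sum_(i <- r | P i) H i).
Proof. by move=> H0; elim/big_ind: _ => // F G; apply: fps_vanishD. Qed.

Lemma fps_vanish_trunc d F : fps_vanish d (F - fps_of_mpoly (fps_trunc d F)).
Proof. by move=> m md; rewrite fcoefD fcoefN /= mcoeff_fps_trunc md subrr. Qed.

Lemma fps_vanish_eq0 F : (forall d, fps_vanish d F) -> F = 0.
Proof. by move=> F0; apply: fpsP => m; apply: F0 (ltnSn _). Qed.

End Density.

(** For the topology given by the order, polynomials are dense; this turns
    every identity between continuous additive operations on series into the
    same identity for polynomials. *)
Lemma fps_additive_density (K : comNzRingType) (n n' : nat)
    (A B : fps K n -> fps K n') c :
    zmod_morphism A -> zmod_morphism B ->
    (forall d F, fps_vanish (d + c) F -> fps_vanish d (A F)) ->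
    (forall d F, fps_vanish (d + c) F -> fps_vanish d (B F)) ->
    (forall q, A (fps_of_mpoly q) = B (fps_of_mpoly q)) ->
  A =1 B.
Proof.
move=> Aadd Badd Acont Bcont AB F; apply/eqP; rewrite -subr_eq0; apply/eqP.
apply: fps_vanish_eq0 => d; set q := fps_trunc (d + c) F.
have -> : A F - B F = A (F - fps_of_mpoly q) - B (F - fps_of_mpoly q).
  by rewrite Aadd Badd AB opprB addrA subrK.
by apply: fps_vanishB; [apply: Acont|apply: Bcont]; apply: fps_vanish_trunc.
Qed.

Section Derivation.
Variables (K : comNzRingType) (n : nat).
Implicit Types (F G : fps K n) (p : {mpoly K[n]}).

Fact fps_deriv_is_zmod_morphism i : zmod_morphism (@fps_deriv K n i).
Proof. by move=> F G; apply: fpsP => m /=; rewrite mulrBr. Qed.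
HB.instance Definition _ i := GRing.isZmodMorphism.Build (fps K n) (fps K n)
  (@fps_deriv K n i) (fps_deriv_is_zmod_morphism i).

Lemma fps_vanish_deriv d i F : fps_vanish (d + 1) F -> fps_vanish d (fps_deriv i F).
Proof. by move=> F0 m md /=; rewrite F0 ?mulr0 // mdegD mdeg1 ltn_add2r. Qed.

Lemma fps_deriv_mpoly i p :
  fps_deriv i (fps_of_mpoly p) = fps_of_mpoly p^`M(i).
Proof. by apply: fpsP => m /=; rewrite mcoeff_deriv mulr_natl. Qed.

Lemma fps_derivM i F G :
  fps_deriv i (F * G) = fps_deriv i F * G + F * fps_deriv i G.
Proof.
pose A H F := fps_deriv i (F * H).
pose B H F := fps_deriv i F * H + F * fps_deriv i H.
have Aadd H : zmod_morphism (A H) by move=> ? ?; rewrite /A mulrBl raddfB.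
have Badd H : zmod_morphism (B H).
  by move=> ? ?; rewrite /B raddfB !mulrBl opprD addrACA.
have Acont H d F' : fps_vanish (d + 1) F' -> fps_vanish d (A H F').
  by move=> F0; apply: fps_vanish_deriv; apply: fps_vanishMl.
have Bcont H d F' : fps_vanish (d + 1) F' -> fps_vanish d (B H F').
  move=> F0; apply: fps_vanishD; apply: fps_vanishMl.
    exact: fps_vanish_deriv.
  by move=> m md; apply: F0; rewrite ltn_addr.
have AB_ext H : (forall q, A H (fps_of_mpoly q) = B H (fps_of_mpoly q)) ->
    A H =1 B H.
  exact: (fps_additive_density (Aadd H) (Badd H) (Acont H) (Bcont H)).
apply: (AB_ext G) => {F} p.
have -> : A G (fps_of_mpoly p) = A (fps_of_mpoly p) G by rewrite /A mulrC.
rewrite (AB_ext (fps_of_mpoly p)) => [|q].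
  by rewrite /B addrC mulrC [X in _ + X]mulrC.
by rewrite /A /B -rmorphM !fps_deriv_mpoly mderivM rmorphD !rmorphM.
Qed.

Lemma fps_derivZ i c F : fps_deriv i (c *: F) = c *: fps_deriv i F.
Proof. by apply: fpsP => m /=; rewrite mulrCA. Qed.

Lemma fps_deriv_var (i j : 'I_n) : fps_deriv i (fps_var K j) = (i == j)%:R.
Proof.
rewrite -fps_of_mpolyX fps_deriv_mpoly mderivX mnm1E eq_sym.
case: eqP => [->|_]; last by rewrite scale0r raddf0.
by rewrite scale1r -[X in (X - _)%MM]add0m addmK mpolyX0 rmorph1.
Qed.

End Derivation.

(** * Substitution is a ring morphism obeying the chain rule *)

Section Composition.
Variables (K : comNzRingType) (n p : nat) (phi : 'I_n -> fps K p).
Hypothesis phi0 : forall i, fcoef (phi i) 0%MM = 0.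
Implicit Types (F G : fps K n).

Lemma fps_comp_is_zmod_morphism : zmod_morphism (fun F => fps_comp F phi).
Proof.
move=> F G; apply: fpsP => m /=; rewrite -sumrB.
by apply: eq_bigr => k _; rewrite mulrBl.
Qed.

Lemma fps_compZ c F : fps_comp (c *: F) phi = c *: fps_comp F phi.
Proof.
apply: fpsP => m /=; rewrite mulr_sumr.
by apply: eq_bigr => k _; rewrite mulrA.
Qed.

Lemma fps_vanish_comp d F : fps_vanish d F -> fps_vanish d (fps_comp F phi).
Proof.
move=> F0 m md /=; rewrite big1 // => k _.
by rewrite F0 ?mul0r // (leq_trans (bmdeg k)).
Qed.

Lemma fps_comp_mpoly (q : {mpoly K[n]}) :
  fps_comp (fps_of_mpoly q) phi = mmap (in_alg (fps K p)) phi q.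
Proof.
apply: fpsP => m; pose d := maxn (mdeg m).+1 (msize q).
rewrite (@fcoef_comp _ _ _ _ _ d) ?leq_maxl // (mmapE d) ?leq_maxr //=.
rewrite (big_morph (fun H : fps K p => fcoef H m) (id1 := 0) (op1 := +%R)) //.
by apply: eq_bigr => k _; rewrite mulr_algl.
Qed.

Lemma fps_compM F G :
  fps_comp (F * G) phi = fps_comp F phi * fps_comp G phi.
Proof.
pose A H F := fps_comp (F * H) phi; pose B H F := fps_comp F phi * fps_comp H phi.
have Aadd H : zmod_morphism (A H).
  by move=> ? ?; rewrite /A mulrBl fps_comp_is_zmod_morphism.
have Badd H : zmod_morphism (B H).
  by move=> ? ?; rewrite /B fps_comp_is_zmod_morphism mulrBl.
have Acont H d F' : fps_vanish (d + 0) F' -> fps_vanish d (A H F').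
  by rewrite addn0 => F0; apply: fps_vanish_comp; apply: fps_vanishMl.
have Bcont H d F' : fps_vanish (d + 0) F' -> fps_vanish d (B H F').
  by rewrite addn0 => F0; apply: fps_vanishMl; apply: fps_vanish_comp.
have AB_ext H : (forall q, A H (fps_of_mpoly q) = B H (fps_of_mpoly q)) ->
    A H =1 B H.
  exact: (fps_additive_density (Aadd H) (Badd H) (Acont H) (Bcont H)).
apply: (AB_ext G) => {F} q.
have -> : A G (fps_of_mpoly q) = A (fps_of_mpoly q) G by rewrite /A mulrC.
rewrite (AB_ext (fps_of_mpoly q)) => [|r]; first by rewrite /B mulrC.
by rewrite /A /B -rmorphM !fps_comp_mpoly rmorphM.
Qed.

Lemma fps_comp1 : fps_comp 1 phi = 1.
Proof. by rewrite -(rmorph1 (@fps_of_mpoly K n)) fps_comp_mpoly rmorph1. Qed.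

Lemma fps_comp_var i : fps_comp (fps_var K i) phi = phi i.
Proof.
by rewrite -fps_of_mpolyX fps_comp_mpoly mmapX mmap1U.
Qed.

Lemma fcoef_comp0 F : fcoef (fps_comp F phi) 0%MM = fcoef F 0%MM.
Proof.
rewrite (@fcoef_comp _ _ _ _ _ 1) ?mdeg0 // (bigD1 (@bm0 n 0)) //= big1 ?addr0.
  by rewrite /fps_monom big1 ?fcoef1 ?eqxx ?mulr1 // => i _; rewrite mnm0E expr0.
by move=> k; rewrite bmeqP -mdeg_eq0; have := bmdeg k; rewrite ltnS leqn0 => ->.
Qed.

Lemma fps_compD F G : fps_comp (F + G) phi = fps_comp F phi + fps_comp G phi.
Proof.
apply: fpsP => m /=; rewrite -big_split /=.
by apply: eq_bigr => k _; rewrite mulrDl.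
Qed.

(** Both sides are derivations along the substitution, so they agree on
    polynomials as soon as they agree on the variables. *)
Lemma fps_chain_rule (j : 'I_p) F :
  fps_deriv j (fps_comp F phi) =
  \sum_(i < n) fps_comp (fps_deriv i F) phi * fps_deriv j (phi i).
Proof.
pose A F := fps_deriv j (fps_comp F phi).
pose B F := \sum_(i < n) fps_comp (fps_deriv i F) phi * fps_deriv j (phi i).
have Aadd : zmod_morphism A.
  by move=> G H; rewrite /A fps_comp_is_zmod_morphism raddfB.
have Badd : zmod_morphism B.
  move=> G H; rewrite /B -sumrB; apply: eq_bigr => i _.
  by rewrite raddfB fps_comp_is_zmod_morphism mulrBl.
have AM G H : A (G * H) = A G * fps_comp H phi + fps_comp G phi * A H.
  by rewrite /A fps_compM fps_derivM.
have BM G H : B (G * H) = B G * fps_comp H phi + fps_comp G phi * B H.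
  rewrite /B mulr_suml mulr_sumr -big_split; apply: eq_bigr => i _ /=.
  by rewrite fps_derivM fps_compD !fps_compM mulrDl [X in X + _]mulrAC mulrA.
have A1 : A 1 = 0.
  by apply: (addrI (A 1)); rewrite addr0 -{3}[1]mulr1 AM fps_comp1 mulr1 mul1r.
have B1 : B 1 = 0.
  by apply: (addrI (B 1)); rewrite addr0 -{3}[1]mulr1 BM fps_comp1 mulr1 mul1r.
have ABvar i : A (fps_var K i) = B (fps_var K i).
  rewrite /A /B fps_comp_var (bigD1 i) //= fps_deriv_var eqxx fps_comp1 mul1r.
  rewrite big1 ?addr0 // => k /negPf ki.
  rewrite fps_deriv_var ki; suff -> : fps_comp (0 : fps K n) phi = 0 by rewrite mul0r.
  by rewrite -(subrr 0) fps_comp_is_zmod_morphism subrr.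
apply: (@fps_additive_density _ _ _ A B 1) => // [d G G0|d G G0|q].
- by apply: fps_vanish_deriv; apply: fps_vanish_comp.
- apply: fps_vanish_sum => i _; apply: fps_vanishMl; apply: fps_vanish_comp.
  exact: fps_vanish_deriv.
elim/mpolyind: q => [|c m q _ _ IHq].
  by rewrite rmorph0 -(subrr 0) Aadd Badd !subrr.
have AZ G : A (c *: G) = c *: A G by rewrite /A fps_compZ fps_derivZ.
have BZ G : B (c *: G) = c *: B G.
  rewrite /B scaler_sumr; apply: eq_bigr => i _.
  by rewrite fps_derivZ fps_compZ scalerAl.
have addD (C : fps K n -> fps K p) : zmod_morphism C ->
    forall G H, C (G + H) = C G + C H.
  move=> CB G H; have C0 : C 0 = 0 by rewrite -(subrr 0) CB subrr.
  by rewrite -[H in LHS]opprK CB -[- H]add0r CB C0 add0r opprK.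
rewrite rmorphD /= fps_of_mpolyZ !addD // IHq AZ BZ mpolyXE_id; congr (_ *: _ + _).
rewrite rmorph_prod; elim/big_ind: _ => [|G H GE HE|i _].
- by rewrite A1 B1.
- by rewrite AM BM GE HE.
rewrite rmorphXn /= fps_of_mpolyX; elim: (m i) => [|k IHk]; first by rewrite A1 B1.
by rewrite exprS AM BM IHk ABvar.
Qed.

End Composition.

Lemma fps_comp_comp (K : comNzRingType) (n p q : nat) (F : fps K n)
    (phi : 'I_n -> fps K p) (psi : 'I_p -> fps K q) :
    (forall i, fcoef (phi i) 0%MM = 0) -> (forall i, fcoef (psi i) 0%MM = 0) ->
  fps_comp (fps_comp F phi) psi = fps_comp F (fun i => fps_comp (phi i) psi).
Proof.
move=> phi0 psi0.
have chi0 i : fcoef (fps_comp (phi i) psi) 0%MM = 0 by rewrite fcoef_comp0.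
pose A F := fps_comp (fps_comp F phi) psi.
apply: (@fps_additive_density _ _ _ A
  (fun G => fps_comp G (fun i => fps_comp (phi i) psi)) 0).
- by move=> G H; rewrite /A !fps_comp_is_zmod_morphism.
- exact: fps_comp_is_zmod_morphism.
- by move=> d G; rewrite addn0 => G0; do 2!apply: fps_vanish_comp.
- by move=> d G; rewrite addn0; apply: fps_vanish_comp.
move=> r; rewrite /A !fps_comp_mpoly // /mmap.
rewrite (big_morph _ (fps_compD psi) (id1 := 0)); last first.
  by rewrite -(subrr 0) fps_comp_is_zmod_morphism subrr.
apply: eq_bigr => m _; rewrite fps_compM // fps_compZ fps_comp1 //.
congr (_ * _); rewrite /mmap1.
rewrite (big_morph _ (fps_compM psi0) (fps_comp1 psi0)).
apply: eq_bigr => i _; elim: (m i) => [|k IHk]; first by rewrite fps_comp1.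
by rewrite !exprS fps_compM ?IHk.
Qed.

(** * Orders, and division by a coordinate *)

Section Order.
Variables (K : idomainType) (n : nat).
Implicit Types (F G : fps K n).

Definition fps_has_order d F :=
  fps_vanish d F /\ exists m, mdeg m = d /\ fcoef F m != 0.

Lemma fps_has_order_exists F : F != 0 -> exists d, fps_has_order d F.
Proof.
move=> F0; pose P d := `[< exists m, mdeg m = d /\ fcoef F m != 0 >].
have exP : exists d, P d.
  apply: contrapT => nP; case/eqP: F0; apply: fpsP => m; apply/eqP.
  apply/negPn/negP => Fm; apply: nP; exists (mdeg m).
  by apply/asboolP; exists m.
have [d /asboolP Pd dmin] := ex_minnP exP.
exists d; split=> // m md; apply/eqP/negPn/negP => Fm.
have : P (mdeg m) by apply/asboolP; exists m.
by move=> /dmin; rewrite leqNgt md.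
Qed.

Lemma fps_vanish_has_order d e F : fps_has_order d F -> fps_vanish e F -> (e <= d)%N.
Proof.
by move=> [_ [m [<- Fm]]] Fe; rewrite leqNgt; apply: contra Fm => /Fe ->.
Qed.

(** The initial form of a product is the product of the initial forms, and
    polynomials have no zero divisors. *)
Lemma fps_has_orderM d e F G :
  fps_has_order d F -> fps_has_order e G -> fps_has_order (d + e) (F * G).
Proof.
have initial c H : fps_has_order c H ->
    fps_trunc c.+1 H != 0 /\ fps_trunc c.+1 H \is c.-homog.
  move=> [H0 [m [mc Hm]]]; split.
    apply: contra Hm => /eqP /(congr1 (mcoeff m)).
    by rewrite mcoeff_fps_trunc mc ltnSn mcoeff0 => ->.
  apply/dhomogP => k; rewrite mcoeff_msupp mcoeff_fps_trunc.
  case: ltnP => kc; last by rewrite eqxx.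
  by rewrite ltnS leq_eqVlt in kc; case/orP: kc => [/eqP//|/H0->]; rewrite eqxx.
move=> Fd Ge; have [p0 ph] := initial _ _ Fd; have [q0 qh] := initial _ _ Ge.
split; first by apply: fps_vanishM; [case: Fd|case: Ge].
have pq0 : fps_trunc d.+1 F * fps_trunc e.+1 G != 0 by rewrite mulf_neq0.
set p := fps_trunc _ _ in p0 ph pq0; set q := fps_trunc _ _ in q0 qh pq0.
exists (mlead (p * q)); have lead := mlead_supp pq0.
have leadE : mdeg (mlead (p * q)) = (d + e)%N.
  by apply: (dhomog_mf (dhomogM ph qh)).
split=> //.
rewrite mcoeff_msupp in lead.
suff -> : fcoef (F * G) (mlead (p * q)) = (p * q)@_(mlead (p * q)) by [].
apply/eqP; rewrite -subr_eq0; apply/eqP.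
have -> : (p * q)@_(mlead (p * q)) = fcoef (fps_of_mpoly (p * q)) (mlead (p * q)).
  by [].
rewrite -fcoefN -fcoefD.
have -> : F * G - fps_of_mpoly (p * q) =
    (F - fps_of_mpoly p) * G + fps_of_mpoly p * (G - fps_of_mpoly q).
  by rewrite rmorphM mulrBl mulrBr addrA subrK.
apply: (_ : fps_vanish (d + e).+1 _); last by rewrite leadE.
apply: fps_vanishD; rewrite -?addSn.
  by apply: fps_vanishM; [apply: fps_vanish_trunc|case: Ge].
rewrite addSn -addnS; apply: fps_vanishM; last exact: fps_vanish_trunc.
have -> : fps_of_mpoly p = F - (F - fps_of_mpoly p) by rewrite opprB addrCA subrr addr0.
apply: fps_vanishB; first by case: Fd.
by move=> m md; apply: fps_vanish_trunc; rewrite ltnW.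
Qed.

End Order.

Section Shift.
Variables (K : comNzRingType) (n : nat) (i : 'I_n).
Implicit Types (F G : fps K n).

Definition fps_shift F : fps K n := Fps (fun m => fcoef F (m + U_(i))%MM).

Lemma fcoef_varM0 F (m : 'X_{1..n}) : m i = 0%N -> fcoef (fps_var K i * F) m = 0.
Proof.
move=> mi; rewrite fcoefM big1 // => -[k1 k2] /= /eqP mE.
case: eqP => [k1E|_]; last by rewrite mul0r.
by move/(congr1 (fun k : 'X_{1..n} => k i)): mE; rewrite /= mi k1E mnmDE mnm1E eqxx.
Qed.

Lemma fcoef_varMS F m : fcoef (fps_var K i * F) (m + U_(i))%MM = fcoef F m.
Proof.
set d := (mdeg (m + U_(i))%MM).+1.
rewrite -[F in LHS](subrK (fps_of_mpoly (fps_trunc d F))) mulrDr fcoefD.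
rewrite (_ : fps_vanish d _) ?add0r ?ltnSn //; last first.
  exact/fps_vanishMr/fps_vanish_trunc.
rewrite -fps_of_mpolyX -rmorphM /= mulrC addmC mcoeffMX mcoeff_fps_trunc.
by rewrite /d mdegD ltnS leq_addr.
Qed.

Lemma fps_var_dvd F : (forall m : 'X_{1..n}, m i = 0%N -> fcoef F m = 0) ->
  F = fps_var K i * fps_shift F.
Proof.
move=> F0; apply: fpsP => m; have [mi|mi] := posnP (m i).
  by rewrite F0 ?fcoef_varM0.
have mE : m = (m - U_(i) + U_(i))%MM by rewrite submK // lep1mP -lt0n.
by rewrite mE fcoef_varMS.
Qed.

End Shift.

Lemma convergent_shift (K : numFieldType) (n : nat) (i : 'I_n) (F : fps K n) :
  convergent F -> convergent (fps_shift i F).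
Proof.
move=> /asboolP[r r0 [M FM]]; apply/asboolP; exists r => //.
exists (r^-1 * M) => d.
have hP (m : 'X_{1..n < d}) : (mdeg (m + U_(i))%MM < d.+1)%N.
  by rewrite mdegD mdeg1 addn1 ltnS bmdeg.
pose h (m : 'X_{1..n < d}) := BMultinom (hP m).
pose g (m : 'X_{1..n < d.+1}) := `|fcoef F m| * r ^+ mdeg m.
have hI : injective h.
  by move=> k l /(congr1 val) /= /addIm kl; apply: val_inj.
apply: (@le_trans _ _ (r^-1 * \sum_m g m)); last first.
  by rewrite ler_wpM2l ?invr_ge0 ?(ltW r0) ?FM.
apply: (@le_trans _ _ (r^-1 * \sum_m g (h m))); last first.
  rewrite ler_wpM2l ?invr_ge0 ?(ltW r0) ?ler_sum_inj // => m.
  by rewrite mulr_ge0 ?exprn_ge0 ?(ltW r0).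
rewrite mulr_sumr; apply: ler_sum => m _; rewrite /g /= mdegD mdeg1 addn1.
by rewrite exprS [leRHS]mulrCA mulKf ?gt_eqF.
Qed.

(** * The ring of convergent power series *)

Section ConvergentRing.
Variables (K : numFieldType) (n : nat).
Implicit Types (F G : cvps K n).

Definition cvps_vanish d F := fps_vanish d (val F).

Lemma cvpsP F G : (forall m, cvcoef F m = cvcoef G m) -> F = G.
Proof. by move=> FG; apply: val_inj; apply: fpsP. Qed.

Lemma cvps_neq0 F : F != 0 -> exists d, fps_has_order d (val F).
Proof.
move=> F0; apply: fps_has_order_exists.
by rewrite -[0]/(val (0 : cvps K n)) (inj_eq val_inj).
Qed.

Lemma cvps_mulf_neq0 F G : F != 0 -> G != 0 -> F * G != 0.
Proof.
move=> /cvps_neq0[d Fd] /cvps_neq0[e Ge].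
have [_ [m [_]]] := fps_has_orderM Fd Ge.
by apply: contra => /eqP FG; rewrite -[val F * val G]/(val (F * G)) FG.
Qed.

Lemma cvps_expf_neq0 F k : F != 0 -> F ^+ k != 0.
Proof.
by move=> F0; elim: k => [|k IHk]; rewrite ?oner_neq0 // exprS cvps_mulf_neq0.
Qed.

Lemma cvvar_neq0 i : cvvar K i != 0 :> cvps K n.
Proof.
apply/eqP => /(congr1 (fun F => cvcoef F U_(i)%MM)) /eqP.
by rewrite /cvcoef /= eqxx oner_eq0.
Qed.

Lemma cvps_mulIf F G H : H != 0 -> F * H = G * H -> F = G.
Proof.
move=> H0 /eqP; rewrite -subr_eq0 -mulrBl => FGH; apply/eqP; rewrite -subr_eq0.
by apply/negPn/negP => /cvps_mulf_neq0 /(_ H0); rewrite FGH.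
Qed.

Definition cvshift i F : cvps K n := Cvps (convergent_shift i (valP F)).

Lemma cvvar_dvd i F : (forall m : 'X_{1..n}, m i = 0%N -> cvcoef F m = 0) ->
  F = cvvar K i * cvshift i F.
Proof. by move=> F0; apply: val_inj; apply: fps_var_dvd. Qed.

Lemma cvcoefD F G m : cvcoef (F + G) m = cvcoef F m + cvcoef G m.
Proof. by []. Qed.
Lemma cvcoefN F m : cvcoef (- F) m = - cvcoef F m.
Proof. by []. Qed.
Lemma cvcoefZ c F m : cvcoef (c *: F) m = c * cvcoef F m.
Proof. by []. Qed.
Lemma cvcoef1 m : cvcoef (1 : cvps K n) m = (m == 0%MM)%:R.
Proof. by []. Qed.

Lemma cvcoef_var0 i : cvcoef (cvvar K i : cvps K n) 0%MM = 0.
Proof. by rewrite /cvcoef /= eq_sym -mdeg_eq0 mdeg1. Qed.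

End ConvergentRing.

Section Substitution.
Variables (K : numFieldType) (n p : nat) (phi : 'I_n -> cvps K p).
Hypothesis phi0 : forall i, cvcoef (phi i) 0%MM = 0.
Implicit Types (F G : cvps K n).

(** Carrying the proof that the substitution is into the maximal ideal makes
    [cvcomp] a ring morphism that the generic lemmas recognize. *)
Definition cvsubst of (forall i, cvcoef (phi i) 0%MM = 0) := fun F => cvcomp F phi.
Local Notation subst := (cvsubst phi0).

Fact cvsubst_is_zmod_morphism : zmod_morphism subst.
Proof.
move=> F G; apply: val_inj; rewrite /= !val_cvcomp //=.
exact: fps_comp_is_zmod_morphism.
Qed.
Fact cvsubst_is_monoid_morphism : monoid_morphism subst.
Proof.
split=> [|F G]; apply: val_inj; rewrite /= !val_cvcomp //=.
  exact: fps_comp1.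
exact: fps_compM.
Qed.
HB.instance Definition _ := GRing.isZmodMorphism.Build (cvps K n) (cvps K p)
  subst cvsubst_is_zmod_morphism.
HB.instance Definition _ := GRing.isMonoidMorphism.Build (cvps K n) (cvps K p)
  subst cvsubst_is_monoid_morphism.

Lemma cvcompD F G : cvcomp (F + G) phi = cvcomp F phi + cvcomp G phi.
Proof. exact: (rmorphD subst). Qed.
Lemma cvcompB F G : cvcomp (F - G) phi = cvcomp F phi - cvcomp G phi.
Proof. exact: (rmorphB subst). Qed.
Lemma cvcompM F G : cvcomp (F * G) phi = cvcomp F phi * cvcomp G phi.
Proof. exact: (rmorphM subst). Qed.
Lemma cvcompX F k : cvcomp (F ^+ k) phi = cvcomp F phi ^+ k.
Proof. exact: (rmorphXn subst). Qed.
Lemma cvcomp1 : cvcomp 1 phi = 1.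
Proof. exact: (rmorph1 subst). Qed.
Lemma cvcomp0 : cvcomp 0 phi = 0.
Proof. exact: (rmorph0 subst). Qed.

Lemma cvcompZ c F : cvcomp (c *: F) phi = c *: cvcomp F phi.
Proof. by apply: val_inj; rewrite /= !val_cvcomp //= fps_compZ. Qed.
Lemma cvcomp_var i : cvcomp (cvvar K i) phi = phi i.
Proof. by apply: val_inj; rewrite val_cvcomp //= fps_comp_var. Qed.
Lemma cvcoef_comp0 F : cvcoef (cvcomp F phi) 0%MM = cvcoef F 0%MM.
Proof. by rewrite /cvcoef val_cvcomp // fcoef_comp0. Qed.

Lemma cv_chain_rule (j : 'I_p) F :
  cvderiv j (cvcomp F phi) =
  \sum_(i < n) cvcomp (cvderiv i F) phi * cvderiv j (phi i).
Proof.
apply: val_inj; rewrite raddf_sum /= val_cvcomp // fps_chain_rule //.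
by apply: eq_bigr => i _; rewrite val_cvcomp.
Qed.

End Substitution.

Lemma cvcomp_comp (K : numFieldType) (n p q : nat) (F : cvps K n)
    (phi : 'I_n -> cvps K p) (psi : 'I_p -> cvps K q) :
    (forall i, cvcoef (phi i) 0%MM = 0) -> (forall i, cvcoef (psi i) 0%MM = 0) ->
  cvcomp (cvcomp F phi) psi = cvcomp F (fun i => cvcomp (phi i) psi).
Proof.
move=> phi0 psi0; apply: val_inj; rewrite !val_cvcomp //; last first.
  by move=> i; rewrite cvcoef_comp0.
rewrite fps_comp_comp //; congr fps_comp; apply/funext => i.
by rewrite val_cvcomp.
Qed.

Lemma cvcomp_id (K : numFieldType) (n : nat) (F : cvps K n) : cvcomp F (@cvvar K n) = F.
Proof.
have var0 := @cvcoef_var0 K n; apply: val_inj; rewrite val_cvcomp //=.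
apply: (@fps_additive_density _ _ _ (fun G => fps_comp G _) id 0) => //.
- exact: fps_comp_is_zmod_morphism.
- by move=> d G; rewrite addn0; apply: fps_vanish_comp.
- by move=> d G; rewrite addn0.
move=> q; rewrite fps_comp_mpoly // [q in RHS]mpolyE rmorph_sum.
apply: eq_bigr => m _; rewrite /= mulr_algl fps_of_mpolyZ mpolyXE_id rmorph_prod.
congr (_ *: _); apply: eq_bigr => i _.
by rewrite rmorphXn /= fps_of_mpolyX.
Qed.

Section Units.
Variable K : numFieldType.

Definition fps_geom : fps K 1 := Fps (fun=> 1).

Lemma mdeg1E (m : 'X_{1..1}) : mdeg m = m 0.
Proof. by rewrite mdegE big_ord1. Qed.

Lemma convergent_geom : convergent fps_geom.
Proof.
apply/asboolP; exists (2^-1); first by rewrite invr_gt0.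
exists 2 => d; pose h (m : 'X_{1..1 < d}) := Ordinal (bmdeg m).
have hI : injective h.
  move=> k l /(congr1 val) /=; rewrite !mdeg1E => kl; apply: val_inj.
  by apply/mnmP => i; rewrite ord1.
pose g (i : 'I_d) : K := 2^-1 ^+ i.
apply: (@le_trans _ _ (\sum_i g i)).
  rewrite /wnorm (eq_bigr (fun m => g (h m))) => [|m _]; last first.
    by rewrite normr1 mul1r.
  by apply: ler_sum_inj => // i; rewrite exprn_ge0 ?invr_ge0.
have : (1 - 2^-1) * (\sum_i g i) <= 1 :> K.
  by rewrite -opprB mulNr -subrX1 opprB gerBl exprn_ge0 ?invr_ge0.
have -> : 1 - 2^-1 = 2^-1 :> K.
  rewrite -[X in X - _](@divff _ 2) ?pnatr_eq0 // -{2}[2^-1]mul1r -mulrBl.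
  by rewrite -[2]natr1 addrK mul1r.
by rewrite mulrC ler_pdivrMr // mul1r.
Qed.

Lemma geomK : (1 - cvvar K 0) * Cvps convergent_geom = 1.
Proof.
set g := Cvps _; rewrite mulrBl mul1r.
have -> : cvvar K 0 * g = g - 1; last by rewrite opprB addrC subrK.
rewrite [RHS](@cvvar_dvd _ _ 0) => [|m m0].
  congr (_ * _); apply: cvpsP => m.
  rewrite -[RHS]/(cvcoef (g - 1) (m + U_(0%R))%MM) cvcoefD cvcoefN cvcoef1.
  by rewrite -mdeg_eq0 mdegD mdeg1 addn1 subr0.
by rewrite cvcoefD cvcoefN cvcoef1 -mdeg_eq0 mdeg1E m0 /cvcoef subrr.
Qed.

(** The inverse of [1 - E], with [E] in the maximal ideal, is the substitution
    of [E] into the geometric series; this makes its convergence an instance of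
    that of composite series. *)
Lemma cvps_unit n (F : cvps K n) : cvcoef F 0%MM != 0 -> exists G, F * G = 1.
Proof.
set c := cvcoef F _ => c0; pose E := 1 - c^-1 *: F.
pose e (_ : 'I_1) := E; have E0 i : cvcoef (e i) 0%MM = 0.
  by rewrite cvcoefD cvcoefN cvcoefZ cvcoef1 eqxx mulVf ?subrr.
pose G := cvcomp (Cvps convergent_geom) e.
have : (1 - E) * G = 1.
  rewrite -[RHS](cvcomp1 E0) -geomK cvcompM // cvcompB // cvcomp1 //.
  by rewrite cvcomp_var.
rewrite opprB addrC subrK -scalerAl scalerAr => FG.
by exists (c^-1 *: G).
Qed.

(** [O_1] is a discrete valuation ring: a nonzero series is a power of the
    parameter times a unit, so divisibility is a comparison of orders. *)
Lemma cvps1_vanish_factor d (F : cvps K 1) : cvps_vanish d F ->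
  exists U, F = cvvar K 0 ^+ d * U.
Proof.
elim: d F => [|d IHd] F F0; first by exists F; rewrite mul1r.
have FX : F = cvvar K 0 * cvshift 0 F.
  by apply: cvvar_dvd => m m0; apply: F0; rewrite mdeg1E m0.
have [|U SU] := IHd (cvshift 0 F).
  by move=> m md; apply: F0; rewrite mdegD mdeg1 addn1.
by exists U; rewrite exprS -mulrA -SU.
Qed.

Lemma cvps_vanish_varX n (i : 'I_n) d : cvps_vanish d (cvvar K i ^+ d).
Proof.
elim: d => [|d IHd]; first by move=> m.
rewrite exprS -add1n; apply: fps_vanishM IHd => m.
by rewrite ltnS leqn0 mdeg_eq0 => /eqP ->; apply: cvcoef_var0.
Qed.

Lemma cvps1_dvdP (F G : cvps K 1) :
  (exists Q, G = Q * F) <-> forall d, cvps_vanish d F -> cvps_vanish d G.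
Proof.
split=> [[Q ->] d Fd|FG]; first exact: fps_vanishMr.
have [F0|F0] := eqVneq F 0.
  exists 0; rewrite mul0r; apply: val_inj; apply: fps_vanish_eq0 => d.
  by apply: FG; rewrite F0.
have [d Fd] := cvps_neq0 F0.
have [U FE] := cvps1_vanish_factor Fd.1.
have [V GE] := cvps1_vanish_factor (FG _ Fd.1).
have U0 : cvcoef U 0%MM != 0.
  apply/negP => /eqP U0; suff : (d.+1 <= d)%N by rewrite ltnn.
  apply: fps_vanish_has_order Fd _; rewrite FE -[d.+1]addn1.
  apply: fps_vanishM; first exact: cvps_vanish_varX.
  by move=> m; rewrite ltnS leqn0 mdeg_eq0 => /eqP ->.
have [W UW] := cvps_unit U0.
by exists (V * W); rewrite FE GE mulrCA -mulrA [W * U]mulrC UW mulr1.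
Qed.

End Units.

Section ExtendedOrder.
Variables (R : realType) (n : nat).
Implicit Types F G : 'O[R]_n.

Lemma cvord_geP d F : (d%:R%:E <= cvord F)%E <-> cvps_vanish d F.
Proof.
split=> [dF m md|Fd]; last first.
  apply: le_ereal_inf_tmp => _ [m Fm <-]; rewrite lee_fin ler_nat leqNgt.
  by apply: contra Fm => /Fd; rewrite /cvcoef => ->.
apply/eqP/negPn/negP => Fm.
suff : (d <= mdeg m)%N by rewrite leqNgt md.
rewrite -(ler_nat R) -lee_fin (le_trans dF) //.
by apply: ereal_inf_lbound; exists m.
Qed.

Lemma cvord0 : cvord (0 : 'O[R]_n) = +oo%E.
Proof.
rewrite /cvord [X in ereal_inf X](_ : _ = set0) ?ereal_inf0 //.
by apply/seteqP; split=> // x [m /= /eqP[]].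
Qed.

Lemma cvord_has_order d F : fps_has_order d (val F) -> cvord F = d%:R%:E.
Proof.
move=> [Fd [m [md Fm]]]; apply/le_anti/andP; split; last exact/cvord_geP.
by apply: ereal_inf_lbound; exists m; rewrite ?md.
Qed.

Lemma cvordM F G : cvord (F * G) = (cvord F + cvord G)%E.
Proof.
have noo (H : 'O[R]_n) : cvord H != -oo%E.
  have [->|/cvps_neq0[d Hd]] := eqVneq H 0; first by rewrite cvord0.
  by rewrite (cvord_has_order Hd).
have [->|/cvps_neq0[d Fd]] := eqVneq F 0; first by rewrite mul0r cvord0 addye.
have [->|/cvps_neq0[e Ge]] := eqVneq G 0; first by rewrite mulr0 cvord0 addey.
rewrite (cvord_has_order Fd) (cvord_has_order Ge) (@cvord_has_order (d + e) (F * G) (fps_has_orderM Fd Ge)).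
by rewrite natrD EFinD.
Qed.

End ExtendedOrder.

Lemma cvord_le_dvdP (R : realType) (F G : 'O[R]_1) :
  (cvord F <= cvord G)%E <-> exists Q, G = Q * F.
Proof.
rewrite cvps1_dvdP; split=> [FG d /cvord_geP Fd|FG].
  by apply/cvord_geP; apply: le_trans FG.
have [G0|G0] := eqVneq G 0; first by rewrite G0 cvord0 leey.
have [F0|/cvps_neq0[d Fd]] := eqVneq F 0; last first.
  by rewrite (cvord_has_order Fd); apply/cvord_geP/FG; case: Fd.
have [d [_ [m [_]]]] := cvps_neq0 G0.
by rewrite [fcoef _ _](FG (mdeg m).+1) ?eqxx // F0.
Qed.

(** * Monomial substitutions *)

Section MonomialSubstitution.
Variables (K : comNzRingType) (n : nat).
Implicit Types (F : fps K n) (m : 'X_{1..n}).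

Lemma fps_comp_rescale (c : 'I_n -> K) F m :
  fcoef (fps_comp F (fun i => c i *: fps_var K i)) m =
  (\prod_i c i ^+ m i) * fcoef F m.
Proof.
have monomE k : fps_monom (fun i => c i *: fps_var K i) k =
    (\prod_i c i ^+ k i) *: fps_of_mpoly 'X_[k].
  rewrite /fps_monom mpolyXE_id rmorph_prod -mulr_algl.
  rewrite -[_%:A]/(in_alg (fps K n) _) rmorph_prod -big_split /=.
  apply: eq_bigr => i _; rewrite rmorphXn /= fps_of_mpolyX.
  rewrite -[_%:A]/(in_alg (fps K n) _) rmorphXn -exprMn /=.
  by rewrite mulr_algl.
rewrite /= (bigD1 (BMultinom (ltnSn (mdeg m)))) //= big1 => [|k].
  by rewrite addr0 monomE fcoefZ /= mcoeffX eqxx mulr1 mulrC.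
by rewrite bmeqP /= => /negPf km; rewrite monomE fcoefZ /= mcoeffX km !mulr0.
Qed.

Variable a : 'I_n -> nat.
Hypothesis a_gt0 : forall i, (0 < a i)%N.

Definition mnm_dilate m : 'X_{1..n} := [multinom (a i * m i)%N | i < n].

Lemma mnm_dilate_inj : injective mnm_dilate.
Proof.
move=> k l /mnmP kl; apply/mnmP => i; have := kl i; rewrite !mnmE => /eqP.
by rewrite eqn_pmul2l // => /eqP.
Qed.

Lemma mdeg_dilate m : (mdeg m <= mdeg (mnm_dilate m))%N.
Proof. by rewrite !mdegE leq_sum // => i _; rewrite mnmE leq_pmull. Qed.

Lemma fcoef_comp_power F m :
  fcoef (fps_comp F (fun i => fps_var K i ^+ a i)) m =
  \sum_(k : 'X_{1..n < (mdeg m).+1} | mnm_dilate k == m) fcoef F k.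
Proof.
rewrite /= [RHS]big_mkcond; apply: eq_bigr => k _.
have -> : fps_monom (fun i => fps_var K i ^+ a i) k = fps_of_mpoly 'X_[mnm_dilate k].
  rewrite /fps_monom mpolyXE_id rmorph_prod; apply: eq_bigr => i _.
  by rewrite rmorphXn /= fps_of_mpolyX mnmE exprM.
by rewrite /= mcoeffX; case: eqP; rewrite ?mulr1 ?mulr0.
Qed.

Lemma fps_comp_power_dilate F m :
  fcoef (fps_comp F (fun i => fps_var K i ^+ a i)) (mnm_dilate m) = fcoef F m.
Proof.
rewrite fcoef_comp_power.
have md : (mdeg m < (mdeg (mnm_dilate m)).+1)%N by rewrite ltnS mdeg_dilate.
by rewrite (big_pred1 (BMultinom md)) // => k; rewrite (inj_eq mnm_dilate_inj) /= bmeqP.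
Qed.

Lemma fps_comp_power_nodilate F m : (forall k, mnm_dilate k <> m) ->
  fcoef (fps_comp F (fun i => fps_var K i ^+ a i)) m = 0.
Proof.
by move=> km; rewrite fcoef_comp_power big1 // => k /eqP /km.
Qed.

(** A left inverse, as an additive map, of the substitution of [X_i ^+ a i]
    for [X_i]. *)
Definition fps_contract F : fps K n := Fps (fun m => fcoef F (mnm_dilate m)).

End MonomialSubstitution.

Lemma convergent_contract (K : numFieldType) (n : nat) (a : 'I_n -> nat)
    (F : fps K n) : (forall i, (0 < a i)%N) ->
  convergent F -> convergent (fps_contract a F).
Proof.
move=> a_gt0 /asboolP[r r0 [M FM]].
have [s s0 /andP[s1 sr]] := common_radius ltr01 r0.
(* Dilation multiplies degrees by at most [b]; as [s <= 1], the weight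
   [s ^+ b] on [m] is then bounded by the weight [s] on the dilated monomial. *)
pose b := \sum_i a i.
have dilate_le (m : 'X_{1..n}) : (mdeg (mnm_dilate a m) <= b * mdeg m)%N.
  rewrite !mdegE big_distrr leq_sum // => i _; rewrite mnmE leq_mul2r.
  by rewrite /b (bigD1 i) //= leq_addr orbT.
apply/asboolP; exists (s ^+ b); first by rewrite exprn_gt0.
exists M => d; apply: le_trans (FM (b * d).+1).
apply: le_trans (wnorm_radius _ _ (ltW s0) sr).
have hP (m : 'X_{1..n < d}) : (mdeg (mnm_dilate a m) < (b * d).+1)%N.
  by rewrite ltnS (leq_trans (dilate_le _)) // leq_mul2l ltnW ?orbT // bmdeg.
pose h (m : 'X_{1..n < d}) := BMultinom (hP m).
pose g (m : 'X_{1..n < (b * d).+1}) := `|fcoef F m| * s ^+ mdeg m.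
have hI : injective h.
  by move=> k l /(congr1 val) /= /(mnm_dilate_inj a_gt0) kl; apply: val_inj.
apply: (@le_trans _ _ (\sum_m g (h m))); last first.
  by apply: ler_sum_inj => // m; rewrite mulr_ge0 ?exprn_ge0 ?(ltW s0).
apply: ler_sum => m _; rewrite /g /= ler_wpM2l // -exprM.
by rewrite ler_wiXn2l ?(ltW s0) ?dilate_le.
Qed.

(** * Series in two variables *)

Section TwoVariables.
Variable K : numFieldType.

Definition pair2 (T : Type) (u v : T) (i : 'I_2) : T := if i == 0 then u else v.

Lemma ord2P (i : 'I_2) : i = 0 \/ i = 1.
Proof. by case: i => [[|[|i]] //= i2]; [left|right]; apply: val_inj. Qed.

Lemma pair2E (T : Type) (u : 'I_2 -> T) : u = pair2 (u 0) (u 1).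
Proof. by apply/funext => i; case: (ord2P i) => ->. Qed.

Lemma eq_pair2 (T : Type) (u : 'I_2 -> T) v w : u 0 = v -> u 1 = w -> u = pair2 v w.
Proof. by move=> <- <-; apply: pair2E. Qed.

Lemma big_ord2 (V : nmodType) (u : 'I_2 -> V) : \sum_(i < 2) u i = u 0 + u 1.
Proof.
by rewrite big_ord_recl big_ord1; congr (_ + u _); apply: val_inj.
Qed.

Lemma fps_monom2 n (phi : 'I_2 -> fps K n) k :
  fps_monom phi k = phi 0 ^+ k 0 * phi 1 ^+ k 1.
Proof.
rewrite /fps_monom big_ord_recl big_ord1.
by have -> : lift ord0 ord0 = 1 :> 'I_2 by apply: val_inj.
Qed.

Lemma pair2_cst0 n (u v : cvps K n) : cvcoef u 0%MM = 0 -> cvcoef v 0%MM = 0 ->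
  forall i, cvcoef (pair2 u v i) 0%MM = 0.
Proof. by move=> u0 v0 i; case: (ord2P i) => ->. Qed.

Local Notation X := (cvvar K 0 : cvps K 2).
Local Notation T := (cvvar K 1 : cvps K 2).
Local Notation t := (cvvar K 0 : cvps K 1).

Definition graph_eq (x : cvps K 1) : cvps K 2 := X - cvcomp x (fun=> T).

Section Graph.
Variable x : cvps K 1.
Hypothesis x0 : cvcoef x 0%MM = 0.
Local Notation phi := (pair2 x t).
Local Notation xT := (cvcomp x (fun=> T)).

Let T0 : forall i : 'I_1, cvcoef T 0%MM = 0.
Proof. by move=> _; apply: cvcoef_var0. Qed.
Let xT0 : cvcoef xT 0%MM = 0.
Proof. by rewrite cvcoef_comp0. Qed.
Let phi0 : forall i, cvcoef (phi i) 0%MM = 0.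
Proof. by apply: pair2_cst0 => //; apply: cvcoef_var0. Qed.

Lemma cvcomp_graph_eq : cvcomp (graph_eq x) phi = 0.
Proof.
rewrite cvcompB // cvcomp_var // cvcomp_comp // [X in cvcomp x X](_ : _ = @cvvar K 1).
  by rewrite cvcomp_id subrr.
by apply/funext => i; rewrite cvcomp_var // ord1.
Qed.

(** Translating [x(t)] to the origin reduces the factor theorem to division by
    a coordinate. *)
Lemma graph_eq_dvd (F : cvps K 2) : cvcomp F phi = 0 ->
  exists G, F = graph_eq x * G.
Proof.
move=> Fphi; pose tau := pair2 (X + xT) T; pose tau' := pair2 (X - xT) T.
have tau0 i : cvcoef (tau i) 0%MM = 0.
  apply: pair2_cst0; rewrite ?cvcoef_var0 // cvcoefD xT0 addr0; exact: cvcoef_var0.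
have tau'0 i : cvcoef (tau' i) 0%MM = 0.
  apply: pair2_cst0; rewrite ?cvcoef_var0 // cvcoefD cvcoefN xT0 subr0.
  exact: cvcoef_var0.
have xT_comp (psi : 'I_2 -> cvps K 2) : (forall i, cvcoef (psi i) 0%MM = 0) ->
    psi 1 = T -> cvcomp xT psi = xT.
  move=> psi0 psiT; rewrite cvcomp_comp //; congr cvcomp; apply/funext => i.
  by rewrite cvcomp_var.
(* Restriction to the axis [X = 0], written as a rescaling of coordinates. *)
pose c (i : 'I_2) : K := (i != 0)%:R.
pose axis i := c i *: cvvar K i.
have axis0 i : cvcoef (axis i) 0%MM = 0.
  by rewrite cvcoefZ cvcoef_var0 mulr0.
have axisT : axis 1 = T by rewrite /axis /c /= scale1r.
have Ftau_axis : cvcomp (cvcomp F tau) axis = 0.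
  rewrite cvcomp_comp //.
  have -> : (fun i => cvcomp (tau i) axis) = pair2 xT T.
    apply: eq_pair2; rewrite /tau /pair2 /= ?cvcompD ?cvcomp_var //.
    by rewrite xT_comp // /axis /c /= scale0r add0r.
  have -> : pair2 xT T = fun i => cvcomp (phi i) (fun=> T).
    by symmetry; apply: eq_pair2; rewrite /pair2 //= cvcomp_var.
  by rewrite -cvcomp_comp // Fphi cvcomp0.
have FtauX : cvcomp F tau = X * cvshift 0 (cvcomp F tau).
  apply: cvvar_dvd => m m0.
  have : cvcoef (cvcomp (cvcomp F tau) axis) m = 0 by rewrite Ftau_axis.
  rewrite /cvcoef [in LHS]val_cvcomp // [in LHS](@fps_comp_rescale _ _ c).
  rewrite big_ord_recl big_ord1 m0 expr0 mul1r /c /= expr1n mul1r.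
  by [].
exists (cvcomp (cvshift 0 (cvcomp F tau)) tau').
rewrite -[graph_eq x]/(tau' 0) -(cvcomp_var tau'0) -cvcompM // -FtauX cvcomp_comp //.
rewrite -[LHS]cvcomp_id; congr cvcomp; symmetry; rewrite [RHS]pair2E.
apply: eq_pair2; rewrite /tau /pair2 /= ?cvcompD ?cvcomp_var // xT_comp //.
by rewrite /tau' /pair2 /= subrK.
Qed.

Lemma cvderiv_graph_eq : cvderiv 0 (graph_eq x) = 1.
Proof.
have derivB : {morph @cvderiv K 2 0 : u v / u - v}.
  by move=> u v; apply: val_inj; rewrite /= raddfB.
have deriv_var j : cvderiv 0 (cvvar K j : cvps K 2) = (0 == j)%:R.
  apply: val_inj; rewrite /= fps_deriv_var.
  by case: (0 == j).
rewrite derivB (@cv_chain_rule _ _ _ (fun=> T)) // big_ord1 !deriv_var.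
by rewrite mulr0 subr0.
Qed.

End Graph.

End TwoVariables.

(** * Radical ideals after adjoining a root of a coordinate *)

Section Radical.
Variable A : comNzRingType.
Implicit Types x y F : A.

Definition rdvd F x := exists u, x = u * F.

Lemma rdvdD F x y : rdvd F x -> rdvd F y -> rdvd F (x + y).
Proof. by move=> [u ->] [v ->]; exists (u + v); rewrite mulrDl. Qed.

Lemma rdvdMl F x y : rdvd F y -> rdvd F (x * y).
Proof. by move=> [u ->]; exists (x * u); rewrite mulrA. Qed.

Lemma rdvd0 F : rdvd F 0.
Proof. by exists 0; rewrite mul0r. Qed.

Lemma rdvd_sum F (I : Type) (r : seq I) (P : pred I) (x : I -> A) :
  (forall i, P i -> rdvd F (x i)) -> rdvd F (\sum_(i <- r | P i) x i).
Proof. by move=> Fx; elim/big_ind: _; [exact: rdvd0|exact: rdvdD|]. Qed.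

Definition in_radical F x := exists k, rdvd F (x ^+ k).

Lemma in_radicalD F x y : in_radical F x -> in_radical F y -> in_radical F (x + y).
Proof.
move=> [k Fx] [l Fy]; exists (k + l)%N; rewrite exprDn; apply: rdvd_sum => i _.
rewrite -mulr_natl; apply: rdvdMl.
have [li|il] := leqP l i.
  by rewrite -(subnK li) exprD mulrA; apply: rdvdMl.
have ki : (k <= k + l - i)%N by rewrite -addnBA ?leq_addr // ltnW.
by rewrite mulrC -(subnK ki) exprD mulrA; apply: rdvdMl.
Qed.

Lemma in_radical_sum F (I : Type) (r : seq I) (P : pred I) (x : I -> A) :
  (forall i, P i -> in_radical F (x i)) -> in_radical F (\sum_(i <- r | P i) x i).
Proof.
move=> Fx; elim/big_ind: _; [|exact: in_radicalD|exact: Fx].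
by exists 1%N; apply: rdvd0.
Qed.

End Radical.

Section Ramification.
Variables (K : numFieldType) (N : nat) (zeta : K).
Hypothesis N_gt0 : (0 < N)%N.
Hypothesis zetaP : N.-primitive_root zeta.

Local Notation T := (cvvar K 1 : cvps K 2).

Let a : 'I_2 -> nat := pair2 1%N N.
Let a_gt0 i : (0 < a i)%N. Proof. by case: (ord2P i) => ->. Qed.

(** The base change [(x, y) = (X, T ^+ N)], in the form to which the results on
    substitutions of powers of the coordinates apply. *)
Definition ramify : 'I_2 -> cvps K 2 := fun i => cvvar K i ^+ pair2 1%N N i.

Lemma ramify_cst0 i : cvcoef (ramify i) 0%MM = 0.
Proof.
by apply: cvps_vanish_varX; rewrite mdeg0; case: (ord2P i) => ->.
Qed.
Hint Resolve ramify_cst0 : core.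

Let val_ramify F : val (cvcomp F ramify) = fps_comp (val F) (fun i => fps_var K i ^+ a i).
Proof.
rewrite val_cvcomp //; congr fps_comp; apply/funext => i.
exact: (rmorphXn (val : cvps K 2 -> fps K 2)).
Qed.

Lemma ramify_inj : injective (fun F : cvps K 2 => cvcomp F ramify).
Proof.
move=> F G /(congr1 val); rewrite !val_ramify => FG; apply: cvpsP => m.
rewrite /cvcoef -(fps_comp_power_dilate a_gt0 (val F)) FG.
exact: fps_comp_power_dilate.
Qed.

(** The deck transformations [T -> zeta ^+ i * T] of the base change. *)
Definition rotate (i : nat) (j : 'I_2) : cvps K 2 := pair2 1 (zeta ^+ i) j *: cvvar K j.

Lemma rotate_cst0 i j : cvcoef (rotate i j) 0%MM = 0.
Proof. by rewrite cvcoefZ cvcoef_var0 mulr0. Qed.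
Hint Resolve rotate_cst0 : core.

Lemma rotate_ramify i F : cvcomp (cvcomp F ramify) (rotate i) = cvcomp F ramify.
Proof.
rewrite cvcomp_comp //; congr cvcomp; apply/funext => j.
rewrite cvcompX // cvcomp_var // exprZn; case: (ord2P j) => ->; rewrite /pair2 /=.
  by rewrite expr1 scale1r.
by rewrite exprAC (prim_expr_order zetaP) expr1n scale1r.
Qed.

Lemma sum_prim_root k :
  \sum_(i < N) (zeta ^+ k) ^+ i = if (N %| k)%N then N%:R else 0.
Proof.
case: ifP => Nk.
  have /eqP -> : zeta ^+ k == 1 by rewrite -(prim_order_dvd zetaP).
  rewrite (eq_bigr (fun=> 1)) => [|i _]; last by rewrite expr1n.
  by rewrite sumr_const card_ord.
apply/eqP; have : (zeta ^+ k - 1) * (\sum_(i < N) (zeta ^+ k) ^+ i) == 0.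
  by rewrite -subrX1 exprAC (prim_expr_order zetaP) expr1n subrr.
by rewrite mulf_eq0 subr_eq0 -(prim_order_dvd zetaP) Nk.
Qed.

(** The trace of [K{X, T}] over [K{X, T^N}]. *)
Definition ramify_trace (V : cvps K 2) := \sum_(i < N) cvcomp V (rotate i).

Lemma ramify_trace_descends V : exists W, ramify_trace V = cvcomp W ramify.
Proof.
exists (N%:R *: Cvps (convergent_contract a_gt0 (valP V))).
rewrite cvcompZ //; apply: cvpsP => m; rewrite cvcoefZ.
have -> : cvcoef (ramify_trace V) m = (if (N %| m 1%R)%N then N%:R else 0) * cvcoef V m.
  rewrite -sum_prim_root mulr_suml /ramify_trace.
  rewrite (big_morph (fun H : cvps K 2 => cvcoef H m) (id1 := 0) (op1 := +%R)) //.
  apply: eq_bigr => i _; rewrite {1}/cvcoef val_cvcomp //.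
  rewrite [LHS](fps_comp_rescale (pair2 1 (zeta ^+ i))) big_ord_recl big_ord1.
  have -> : lift ord0 ord0 = 1 :> 'I_2 by apply: val_inj.
  by rewrite expr1n mul1r exprAC.
rewrite /cvcoef val_ramify; case: ifP => Nm.
  have -> : m = mnm_dilate a [multinom pair2 (m 0%R) (m 1%R %/ N)%N i | i < 2].
    apply/mnmP => i; rewrite !mnmE; case: (ord2P i) => ->; rewrite /a /pair2 /=.
      by rewrite mul1n.
    by rewrite mulnC divnK.
  by rewrite fps_comp_power_dilate.
rewrite fps_comp_power_nodilate ?mulr0 ?mul0r // => k km; case/negP: Nm.
by rewrite -km mnmE dvdn_mulr.
Qed.

Lemma ramify_trace_mul F V :
  ramify_trace (cvcomp F ramify * V) = cvcomp F ramify * ramify_trace V.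
Proof.
by rewrite mulr_sumr; apply: eq_bigr => i _; rewrite cvcompM // rotate_ramify.
Qed.

Lemma ramify_trace_ramify F : ramify_trace (cvcomp F ramify) = N%:R *: cvcomp F ramify.
Proof.
rewrite -[cvcomp F _]mulr1 ramify_trace_mul /ramify_trace.
rewrite (eq_bigr (fun=> 1)) => [|i _]; last by rewrite cvcomp1.
by rewrite sumr_const card_ord scaler_nat mulr1 mulr_natr.
Qed.

(** Divisibility descends along the ramification: apply the trace to the
    quotient. *)
Lemma rdvd_ramify F H : rdvd (cvcomp F ramify) (cvcomp H ramify) -> rdvd F H.
Proof.
move=> [u HE]; have [W WE] := ramify_trace_descends u.
exists (N%:R^-1 *: W); apply: ramify_inj; rewrite /= cvcompM // cvcompZ // -WE.
rewrite -scalerAl mulrC -ramify_trace_mul mulrC -HE ramify_trace_ramify.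
by rewrite scalerA mulVf ?scale1r // pnatr_eq0 -lt0n.
Qed.

(** Up to the ramification divisor, radicality is preserved: the traces of all
    multiples of [H] are nilpotent modulo [f], hence divisible by [f], and
    [T ^+ N * H] is a combination of such traces. *)
Lemma ramify_radical f H :
    (forall h, in_radical f h -> rdvd f h) ->
    in_radical (cvcomp f ramify) H ->
  rdvd (cvcomp f ramify) (T ^+ N * H).
Proof.
move=> frad [m FH]; set F := cvcomp f ramify in FH *.
have trace_dvd V : rdvd F (ramify_trace (V * H)).
  have [W WE] := ramify_trace_descends (V * H).
  have : in_radical F (ramify_trace (V * H)).
    apply: in_radical_sum => i _; exists m; rewrite -cvcompX // exprMn.
    have [u HE] := FH; exists (cvcomp (V ^+ m * u) (rotate i)).
    by rewrite HE mulrA cvcompM // rotate_ramify.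
  move=> [k]; rewrite WE -cvcompX // => /rdvd_ramify Wk.
  have [w ->] := frad W (ex_intro _ k Wk).
  by exists (cvcomp w ramify); rewrite cvcompM.
have rot0 V : cvcomp V (rotate 0) = V.
  rewrite -[RHS]cvcomp_id; congr cvcomp; apply/funext => j.
  by rewrite /rotate expr0; case: (ord2P j) => ->; rewrite /pair2 scale1r.
have : rdvd F (\sum_(k < N) T ^+ k * ramify_trace (T ^+ (N - k) * H)).
  by apply: rdvd_sum => k _; apply: rdvdMl.
suff -> : \sum_(k < N) T ^+ k * ramify_trace (T ^+ (N - k) * H) = N%:R *: (T ^+ N * H).
  move=> [u HE]; exists (N%:R^-1 *: u); rewrite -scalerAl -HE scalerA.
  by rewrite mulVf ?scale1r // pnatr_eq0 -lt0n.
(* Conjugation by [zeta ^+ i] scales [T ^+ (N - k)] by [zeta ^+ (i * (N - k))];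
   summing over [k] annihilates every conjugate but the identity. *)
have termE (k i : 'I_N) : T ^+ k * cvcomp (T ^+ (N - k) * H) (rotate i) =
    (zeta ^+ i) ^+ (N - k) *: (T ^+ N * cvcomp H (rotate i)).
  rewrite cvcompM // cvcompX // cvcomp_var // /rotate exprZn /pair2 /=.
  by rewrite -scalerAl scalerAr -/(rotate _) mulrA -scalerAr -exprD subnKC // ltnW.
under eq_bigr do rewrite /ramify_trace mulr_sumr.
rewrite exchange_big /=.
under eq_bigr => i _ do under eq_bigr => k _ do rewrite termE.
under eq_bigr => i _ do rewrite -scaler_suml.
rewrite (bigD1 (Ordinal N_gt0)) //= rot0 [X in _ + X]big1 ?addr0 => [|i iN0].
  congr (_ *: _); rewrite (eq_bigr (fun=> 1)) ?sumr_const ?card_ord // => k _.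
  by rewrite expr0 expr1n.
rewrite (reindex_inj rev_ord_inj) /= (eq_bigr (fun k : 'I_N => (zeta ^+ i) * (zeta ^+ i) ^+ k)).
  rewrite -mulr_sumr sum_prim_root gtnNdvd ?mulr0 ?scale0r // lt0n.
  exact: iN0.
by move=> k _; rewrite subKn // exprS.
Qed.

End Ramification.

(** * Partial derivatives of a reduced germ along a branch *)

(** In characteristic 0 the [n] roots of ['X^n - 1] are distinct, and [n]
    distinct roots of unity of order dividing [n] form a cyclic group. *)
Lemma closed_field_prim_root (C : numClosedFieldType) n : (0 < n)%N ->
  exists z : C, n.-primitive_root z.
Proof.
move=> n_gt0; pose p : {poly C} := 'X^n - 1.
have [r Dp] := closed_field_poly_normal p.
rewrite (monicP _) ?monicXnsubC // scale1r in Dp.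
have rn1 : all n.-unity_root r by apply/allP=> z; rewrite -root_prod_XsubC -Dp.
have sz_r : (n < (size r).+1)%N.
  by rewrite -(size_prod_XsubC r id) -Dp size_XnsubC.
have [|z] := hasP (has_prim_root n_gt0 rn1 _ sz_r); last by exists z.
by rewrite -separable_prod_XsubC -Dp separable_Xn_sub_1 // pnatr_eq0 -lt0n.
Qed.

Section Reduced.
Variables (K : numFieldType) (N : nat) (zeta : K).
Hypothesis N_gt0 : (0 < N)%N.
Hypothesis zetaP : N.-primitive_root zeta.

Local Notation T := (cvvar K 1 : cvps K 2).
Local Notation t := (cvvar K 0 : cvps K 1).

Lemma cvderiv_eq0 (F : cvps K 1) : cvderiv 0 F = 0 -> cvcoef F 0%MM = 0 -> F = 0.
Proof.
move=> dF F0; apply: cvpsP => m; have [m0|m0] := posnP (m 0).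
  suff -> : m = 0%MM by [].
  by apply/eqP; rewrite -mdeg_eq0 mdeg1E m0.
have mE : m = (m - U_(0%R) + U_(0%R))%MM by rewrite submK // lep1mP -lt0n.
have := congr1 (fun G => cvcoef G (m - U_(0%R))%MM) dF.
rewrite /cvcoef /= -mE => /eqP; rewrite mulf_eq0 pnatr_eq0 /=.
by move/eqP.
Qed.

(** If both partial derivatives vanish along the branch then so does [f], by
    the chain rule, and the ramified germ [F] is divisible by the square of
    the equation [P] of the graph of [x], say [F = P^2 H].  Then [P H] is
    nilpotent modulo [F], so that [F] divides [T^N P H]; thus [P] divides
    [T^N], which is absurd on the graph. *)
Lemma reduced_critical_branch (f : cvps K 2) (x : cvps K 1) :
    f != 0 -> cvcoef f 0%MM = 0 -> (forall h, in_radical f h -> rdvd f h) ->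
    cvcoef x 0%MM = 0 ->
    cvcomp (cvderiv 0 f) (pair2 x (t ^+ N)) = 0 ->
    cvcomp (cvderiv 1 f) (pair2 x (t ^+ N)) = 0 ->
  False.
Proof.
move=> f_neq0 f0 frad x0 fx fy.
have tN0 : cvcoef (t ^+ N) 0%MM = 0 by apply: cvps_vanish_varX; rewrite mdeg0.
have B0 := pair2_cst0 x0 tN0; have phi0 := pair2_cst0 x0 (@cvcoef_var0 K 1 0).
set B := pair2 x (t ^+ N) in fx fy B0; set phi := pair2 x t in phi0.
have ram0 := ramify_cst0 K N_gt0.
have fB : cvcomp f B = 0.
  apply: cvderiv_eq0; last by rewrite cvcoef_comp0.
  by rewrite cv_chain_rule // big_ord2 fx fy !mul0r addr0.
have ram_phi h : cvcomp (cvcomp h (ramify K N)) phi = cvcomp h B.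
  rewrite cvcomp_comp //; congr cvcomp; apply: eq_pair2.
    by rewrite cvcompX // cvcomp_var // expr1.
  by rewrite cvcompX // cvcomp_var.
set F := cvcomp f (ramify K N); set P := graph_eq x.
have PphiB := cvcomp_graph_eq x0; rewrite -/P -/phi in PphiB.
have [G FE] : exists G, F = P * G by apply: graph_eq_dvd; rewrite // ram_phi fB.
have dFphi : cvcomp (cvderiv 0 F) phi = 0.
  rewrite /F cv_chain_rule // big_ord2 cvcompD // !cvcompM // !ram_phi.
  by rewrite fx fy !mul0r addr0.
have derivM (u v : cvps K 2) : cvderiv 0 (u * v) = cvderiv 0 u * v + u * cvderiv 0 v.
  by apply: val_inj; rewrite /= fps_derivM.
have [H GE] : exists H, G = P * H.
  apply: graph_eq_dvd => //; move: dFphi; rewrite FE derivM cvderiv_graph_eq mul1r.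
  by rewrite cvcompD // cvcompM // PphiB mul0r addr0.
have F_neq0 : F != 0.
  apply: contra f_neq0 => /eqP F0; apply/eqP.
  by apply: (@ramify_inj K N N_gt0); rewrite /= cvcomp0.
have G_neq0 : G != 0 by apply: contra F_neq0 => /eqP G0; rewrite FE G0 mulr0.
have [V TG] : rdvd F (T ^+ N * G).
  apply: (ramify_radical N_gt0 zetaP frad); exists 2%N; exists H.
  by rewrite -/F FE expr2 {1}GE mulrA [H * P]mulrC.
have TE : T ^+ N = V * P.
  by apply: (cvps_mulIf G_neq0); rewrite TG FE mulrA.
have := congr1 (fun u => cvcomp u phi) TE.
rewrite /= cvcompX // cvcomp_var // cvcompM // PphiB mulr0 /phi /pair2 /=.
by apply/eqP; apply: cvps_expf_neq0; apply: cvvar_neq0.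
Qed.

End Reduced.

(** * The double of the jacobian ideal along two polar branches *)

Section SubmoduleGenerated.
Variables (A : pzRingType) (V : lmodType A).

Lemma submod_gen_incl (S : set V) v : S v -> submod_gen S v.
Proof.
move=> Sv; exists 1%N, (fun=> 1), (fun=> v); split=> //.
by rewrite big_ord1 scale1r.
Qed.

Lemma submod_gen_min (S : set V) (P : V -> Prop) :
    P 0 -> (forall u v, P u -> P v -> P (u + v)) ->
    (forall c v, P v -> P (c *: v)) -> (forall v, S v -> P v) ->
  forall v, submod_gen S v -> P v.
Proof.
move=> P0 PD PZ SP v [k [c [w [Sw ->]]]].
by elim/big_ind: _ => // i _; apply/PZ/SP.
Qed.

End SubmoduleGenerated.

Section PolarPair.
Variables (R : realType) (f : 'O[R]_2) (a : R[i]) (N : nat).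
Variables (B1 B2 : 'I_2 -> 'O[R]_1).
Hypothesis N_gt0 : (0 < N)%N.
Hypotheses (B1f : is_polar_branch f a N B1) (B2f : is_polar_branch f a N B2).

Local Notation t := (cvvar R[i] 0 : 'O[R]_1).
Local Notation Phi := (pair_param B1 B2).
Local Notation F1 := (cvcomp (dy f) B1).
Local Notation F2 := (cvcomp (dy f) B2).

Lemma branch_cst0 (B : 'I_2 -> 'O[R]_1) : is_branch_param N B -> forall i, cvcoef (B i) 0%MM = 0.
Proof.
move=> [x0 BE] i; case: (ord2P i) => -> //.
by rewrite BE; apply: cvps_vanish_varX; rewrite mdeg0.
Qed.

Let B10 : forall i, cvcoef (B1 i) 0%MM = 0.
Proof. by case: B1f => _ /branch_cst0. Qed.
Let B20 : forall i, cvcoef (B2 i) 0%MM = 0.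
Proof. by case: B2f => _ /branch_cst0. Qed.

Lemma pair_param_cst0 i : cvcoef (Phi i) 0%MM = 0.
Proof. by rewrite /pair_param; case: (split i). Qed.
Let Phi0 := pair_param_cst0.

Lemma polar_branch_dx (B : 'I_2 -> 'O[R]_1) : is_polar_branch f a N B ->
  cvcomp (dx f) B = a *: cvcomp (dy f) B.
Proof.
move=> [_ /branch_cst0 B0]; rewrite /polar cvcompB // cvcompZ // => /eqP.
by rewrite subr_eq0 => /eqP.
Qed.

(** The branches have the same second coordinate [y], so on a monomial the
    difference is [(x_1 ^+ i - x_2 ^+ i) * y ^+ j], a multiple of [x_1 - x_2]. *)
Lemma contact_dvd (w : 'O[R]_2) : rdvd (B1 0 - B2 0) (cvcomp w B1 - cvcomp w B2).
Proof.
apply/cvps1_dvdP => d Bd m md.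
rewrite [LHS](_ : _ = fcoef (fps_comp (val w) (fun i => val (B1 i))) m -
  fcoef (fps_comp (val w) (fun i => val (B2 i))) m); last first.
  by rewrite -!val_cvcomp.
rewrite /= -sumrB big1 // => k _; rewrite -mulrBr.
suff : fps_vanish d (fps_monom (fun i => val (B1 i)) k - fps_monom (fun i => val (B2 i)) k).
  by move=> /(_ m md); rewrite fcoefD fcoefN => ->; rewrite mulr0.
have yE : B1 1 = B2 1 by case: B1f B2f => _ [_ ->] _ [_ [_ ->] _].
rewrite !fps_monom2 yE -mulrBl; apply: fps_vanishMl; rewrite subrXX; apply: fps_vanishMl.
exact: Bd.
Qed.

Definition col2 (p q : 'O[R]_1) : 'cV['O[R]_1]_2 := \col_(i < 2) pair2 p q i.

Lemma pullback_double h :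
  pullback Phi (double_sq h) = col2 (cvcomp h B1) (cvcomp h B2).
Proof.
have split_param i : cvcoef (proj1_sq R i) 0%MM = 0 /\ cvcoef (proj2_sq R i) 0%MM = 0.
  by split; apply: cvcoef_var0.
apply/matrixP => i j; rewrite !mxE; case: (ord2P i) => ->; rewrite /pair2 /=.
  rewrite cvcomp_comp // => [|k]; last by case: (split_param k).
  congr cvcomp; apply/funext => k; rewrite cvcomp_var // /pair_param.
  by rewrite -[lshift 2 k]/(unsplit (inl k)) unsplitK.
rewrite cvcomp_comp // => [|k]; last by case: (split_param k).
congr cvcomp; apply/funext => k; rewrite cvcomp_var // /pair_param.
by rewrite -[rshift 2 k]/(unsplit (inr k)) unsplitK.
Qed.

Lemma pullbackD u v : pullback Phi (u + v) = pullback Phi u + pullback Phi v.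
Proof. by apply/matrixP => i j; rewrite !mxE cvcompD. Qed.

Lemma pullback0 : pullback Phi 0 = 0.
Proof. by apply/matrixP => i j; rewrite !mxE cvcomp0. Qed.

Lemma pullbackZ c v : pullback Phi (c *: v) = cvcomp c Phi *: pullback Phi v.
Proof. by apply/matrixP => i j; rewrite !mxE cvcompM. Qed.

(** On a polar branch [dx f] is a multiple of [dy f], so a generator pulls back
    to [(w(B1) F1, w(B2) F2)] with [w] in [O_2] arbitrary; the pairs
    [(w(B1), w(B2))] span all [(p, q)] congruent modulo [x_1 - x_2], already for
    [w = 1] and [w = x]. *)
Lemma pullback_moduleP v :
  pullback_module Phi (jacobian_double f) v <->
  exists p q, v = col2 (p * F1) (q * F2) /\ rdvd (B1 0 - B2 0) (p - q).
Proof.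
split=> [|[p [q [-> [r pq]]]]].
  pose P v := exists p q, v = col2 (p * F1) (q * F2) /\ rdvd (B1 0 - B2 0) (p - q).
  have P0 : P 0.
    exists 0, 0; rewrite !mul0r subr0; split; last exact: rdvd0.
    by apply/matrixP => i j; rewrite !mxE /pair2 if_same.
  have PD u w : P u -> P w -> P (u + w).
    move=> [p [q [-> pq]]] [p' [q' [-> pq']]]; exists (p + p'), (q + q').
    split; last by rewrite opprD addrACA; apply: rdvdD.
    by apply/matrixP => i j; rewrite !mxE /pair2; case: ifP; rewrite mulrDl.
  have PZ c w : P w -> P (c *: w).
    move=> [p [q [-> pq]]]; exists (c * p), (c * q).
    split; last by rewrite -mulrBr; apply: rdvdMl.
    by apply/matrixP => i j; rewrite !mxE /pair2; case: ifP; rewrite mulrA.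
  apply: (submod_gen_min P0 PD PZ) => _ [u Ju <-].
  apply: (submod_gen_min (P := fun u => P (pullback Phi u))) Ju.
  - by rewrite pullback0.
  - by move=> u1 u2; rewrite pullbackD; apply: PD.
  - by move=> c u1; rewrite pullbackZ; apply: PZ.
  move=> _ [h [b [c ->]] <-]; rewrite pullback_double.
  exists (cvcomp (a *: b + c) B1), (cvcomp (a *: b + c) B2).
  split; last exact: contact_dvd.
  rewrite !(cvcompD, cvcompM, cvcompZ) // !polar_branch_dx //.
  by congr col2; rewrite mulrDl -scalerAl scalerAr.
have gen h : [set pullback Phi v | v in jacobian_double f]%classic
    (pullback Phi (double_sq (h * dy f))).
  exists (double_sq (h * dy f)) => //; apply: submod_gen_incl.
  by exists (h * dy f) => //; exists 0, h; rewrite mul0r add0r.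
pose X : 'O[R]_2 := cvvar R[i] 0.
exists 2%N, (pair2 (p - r * B1 0) r).
exists (pair2 (pullback Phi (double_sq (1 * dy f))) (pullback Phi (double_sq (X * dy f)))).
split; first by move=> i; case: (ord2P i) => ->; apply: gen.
have qE : q = p - r * (B1 0 - B2 0) by rewrite -pq opprB addrC subrK.
rewrite big_ord2 /pair2 /= !pullback_double !cvcompM // cvcomp1 // cvcomp1 //.
rewrite !cvcomp_var // !mul1r; apply/matrixP => i j; rewrite !mxE /pair2.
case: ifP => _.
  by rewrite mulrBl -mulrA subrK.
by rewrite qE mulrA -mulrDl mulrBr opprB addrAC addrA.
Qed.

Lemma pullback_double_det g : cvcomp (double_det g f) Phi =
  cvcomp g B1 * F2 - cvcomp g B2 * F1.
Proof.
have det2 (A : comNzRingType) (M : 'M[A]_2) : \det M = M 0 0 * M 1 1 - M 0 1 * M 1 0.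
  have lift0 : lift 0 0 = 1 :> 'I_2 by apply: val_inj.
  have lift1 : lift 1 0 = 0 :> 'I_2 by apply: val_inj.
  rewrite (expand_det_row _ 0) big_ord2 /cofactor !det_mx11 !mxE lift0 lift1.
  by rewrite expr0 expr1 mul1r mulN1r mulrN.
have pbE h i : cvcomp (double_sq h i 0) Phi = pair2 (cvcomp h B1) (cvcomp h B2) i.
  by have /matrixP /(_ i 0) := pullback_double h; rewrite !mxE.
rewrite /double_det det2 cvcompB // !cvcompM //.
have left_col (M M' : 'cV['O[R]_(2 + 2)]_2) i : (row_mx M M' : 'M_(1 + 1)) i 0 = M i 0.
  by rewrite -(row_mxEl M M'); congr (row_mx _ _ _ _); apply: val_inj.
have right_col (M M' : 'cV['O[R]_(2 + 2)]_2) i : (row_mx M M' : 'M_(1 + 1)) i 1 = M' i 0.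
  by rewrite -(row_mxEr M M'); congr (row_mx _ _ _ _); apply: val_inj.
rewrite !left_col !right_col !pbE /pair2 /=.
by congr (_ - _); rewrite mulrC.
Qed.

End PolarPair.

(** On the branch [dx f] is a multiple of [dy f], so the vanishing of [dy f]
    would make every point of the branch critical for [f]. *)
Lemma polar_branch_dy_neq0 (R : realType) (f : 'O[R]_2) (a : R[i]) (N : nat)
    (B : 'I_2 -> 'O[R]_1) : (0 < N)%N -> reduced_curve f ->
  is_polar_branch f a N B -> cvcomp (dy f) B != 0.
Proof.
move=> N_gt0 [f_neq0 f0 frad] Bf; apply/negP => /eqP dyB.
have [zeta zetaP] := closed_field_prim_root R[i] N_gt0.
have dxB := polar_branch_dx N_gt0 Bf; rewrite dyB scaler0 in dxB.
have [_ [x0 BN] _] := Bf; have BE := eq_pair2 (erefl (B 0)) BN.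
rewrite BE in dxB dyB; apply: (reduced_critical_branch N_gt0 zetaP f_neq0 f0 _ x0 dxB dyB).
by move=> h [k]; apply: frad.
Qed.

Theorem proposition3p5 (R : realType) (f g : 'O[R]_2) (a : R[i]) (N : nat)
    (B1 B2 : 'I_2 -> 'O[R]_1) :
  reduced_curve f -> (0 < N)%N ->
  is_polar_branch f a N B1 -> is_polar_branch f a N B2 ->
  let Phi := pair_param B1 B2 in
  let e1 := intersection_order (dy f) B1 in
  let e2 := intersection_order (dy f) B2 in
  (cvcomp (double_det g f) Phi = 0 ->
     (pullback_module Phi (jacobian_double f) (pullback Phi (double_sq g)) <->
      (e1 <= intersection_order g B1)%E /\ (e2 <= intersection_order g B2)%E)) /\
  (cvord (cvcomp (double_det g f) Phi) =
     Order.min (intersection_order g B1 + e2)%E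
               (intersection_order g B2 + e1)%E ->
     (pullback_module Phi (jacobian_double f) (pullback Phi (double_sq g)) <->
      (e1 + contact B1 B2 <= intersection_order g B1)%E /\
      (e2 + contact B1 B2 <= intersection_order g B2)%E)).
Proof.
move=> f_red N_gt0 B1f B2f Phi e1 e2.
have F1_neq0 := polar_branch_dy_neq0 N_gt0 f_red B1f.
have F2_neq0 := polar_branch_dy_neq0 N_gt0 f_red B2f.
rewrite (pullback_moduleP N_gt0 B1f B2f) (pullback_double N_gt0 B1f B2f).
rewrite (pullback_double_det N_gt0 B1f B2f).
rewrite /e1 /e2 /intersection_order /contact {Phi e1 e2} -!cvordM !cvord_le_dvdP.
set F1 := cvcomp (dy f) B1 in F1_neq0 *; set F2 := cvcomp (dy f) B2 in F2_neq0 *.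
set g1 := cvcomp g B1; set g2 := cvcomp g B2; set c := B1 0 - B2 0.
have -> : (exists p q, col2 g1 g2 = col2 (p * F1) (q * F2) /\ rdvd c (p - q)) <->
    (exists p q, [/\ g1 = p * F1, g2 = q * F2 & rdvd c (p - q)]).
  split=> [[p [q [/matrixP gE cpq]]]|[p [q [-> -> cpq]]]]; exists p, q; split=> //.
    by have := gE 0 0; rewrite !mxE.
  by have := gE 1 0; rewrite !mxE.
split=> [D0|Dord]; split.
- by move=> [p [q [-> -> _]]]; split; [exists p|exists q].
- move=> [[p g1E] [q g2E]]; exists p, q; split=> //; exists 0.
  apply/eqP; rewrite mul0r subr_eq0; apply/eqP.
  apply: (cvps_mulIf (cvps_mulf_neq0 F1_neq0 F2_neq0)); apply/eqP.
  by rewrite -subr_eq0 mulrA -g1E [F1 * F2]mulrC mulrA -g2E D0.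
- move=> [p [q [g1E g2E [r pqE]]]].
  have [D1 D2] : rdvd (c * F1 * F2) (g1 * F2) /\ rdvd (c * F1 * F2) (g2 * F1).
    (* The order of the determinant is at least that of [c F1 F2], and it is
       the minimum of the orders of its two terms. *)
    have cD : (cvord (c * F1 * F2)%R <= cvord (g1 * F2 - g2 * F1)%R)%E.
      apply/cvord_le_dvdP; exists r; rewrite g1E g2E.
      by rewrite [q * F2 * F1]mulrAC -mulrBl -mulrBl pqE !mulrA.
    by move: cD; rewrite Dord le_min => /andP[/cvord_le_dvdP ? /cvord_le_dvdP ?].
  split.
    have [u] := D1; rewrite !mulrA => /(cvps_mulIf F2_neq0) ->; exists u.
    by rewrite -mulrA [c * F1]mulrC.
  have [u] := D2; rewrite mulrAC !mulrA => /(cvps_mulIf F1_neq0) ->; exists u.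
  by rewrite -mulrA [c * F2]mulrC.
- move=> [[u g1E] [v g2E]]; exists (u * c), (v * c).
  split; first by rewrite g1E -mulrA [c * F1]mulrC.
    by rewrite g2E -mulrA [c * F2]mulrC.
  by rewrite -mulrBl; exists (u - v).
Qed.
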